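(* Let $\mathbb{F}\in\{\mathbb{R},\mathbb{C},\mathbb{H}\}$, with $\beta=1,2,4$ respectively, let $p\in[1,\infty)$ ($p=p_n$ may depend on $n$), and write $M_p=M_{2,\beta,\beta-1,p}$. As $n\to\infty$, $$\frac{M_p(x_1^4)}{M_p(1)}\ \ge\ \Bigl(\frac32+o(1)\Bigr)\left(\frac{M_p(x_1^2)}{M_p(1)}\right)^2,$$ and hence $$n\cdot\mathrm{Var}_{M_p}(x_1^2)\ \ge\ \Bigl(\frac n2+o(n)\Bigr)\left(\frac{M_p(x_1^2)}{M_p(1)}\right)^2\simeq n\cdot n^{4/p}.$$ Consequently, for the quantity $$\mathrm{Var}_{M_p}\bigl(\|x\|_2^2\bigr)=n\cdot\mathrm{Var}_{M_p}(x_1^2)+n(n-1)\left[\frac{M_p(x_1^2x_2^2)}{M_p(1)}-\left(\frac{M_p(x_1^2)}{M_p(1)}\right)^2\right]$$ to be bounded by $n^{4/p}$, or even to be $o(n\cdot n^{4/p})$, it is necessary that the cross terms be negative; that is, if $\mathrm{Var}_{M_p}(\|x\|_2^2)=o(n\cdot n^{4/p})$ as $n\to\infty$ (with $p=p_n$), then for all sufficiently large $n$ $$\frac{M_p(x_1^2x_2^2)}{M_p(1)}-\left(\frac{M_p(x_1^2)}{M_p(1)}\right)^2<0.$$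
   Context: For $p\in[1,\infty)$ and a function $F$ on $\mathbb{R}^n$, $$M_{2,\beta,\beta-1,p}(F)=\int_{\mathbb{R}^n}F(x)\,e^{-\|x\|_p^p}\prod_{1\le i<j\le n}|x_i^2-x_j^2|^{\beta}\prod_{1\le i\le n}|x_i|^{\beta-1}\,dx ,$$ where $\|x\|_p$ is the $\ell_p$ norm. The values $\beta=1,2,4$ correspond to the spaces of $n\times n$ matrices over $\mathbb{R},\mathbb{C},\mathbb{H}$. Variances are with respect to the probability density proportional to $e^{-\|x\|_p^p}\prod_{i<j}|x_i^2-x_j^2|^{\beta}\prod_i|x_i|^{\beta-1}$: $\mathrm{Var}_{M_p}(G)=\frac{M_p(G^2)}{M_p(1)}-\bigl(\frac{M_p(G)}{M_p(1)}\bigr)^2$. $A\simeq B$ means $c_1A\le B\le c_2A$ for absolute constants $c_1,c_2>0$ (for all large $n$). $A=o(B)$ means $A/B\to0$ as $n\to\infty$. *)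

(* Defs.v *)
From HB Require Import structures.
From mathcomp Require Import all_boot all_order all_algebra.
From mathcomp Require Import all_classical all_reals all_analysis.
Set Implicit Arguments.
Unset Strict Implicit.
Unset Printing Implicit Defensive.
Import Order.TTheory GRing.Theory Num.Theory.
Import numFieldNormedType.Exports.
Local Open Scope classical_set_scope.
Local Open Scope ring_scope.

Section cons_measure.
Local Open Scope ereal_scope.
Context d (T : measurableType d) (R : realType) (n : nat).
Variable mu : {sigma_finite_measure set T -> \bar R}.
Variable nu : {sigma_finite_measure set (n.-tuple T) -> \bar R}.

Definition cons_pair (z : T * n.-tuple T) : n.+1.-tuple T :=
  [tuple of z.1 :: z.2].

Lemma measurable_cons_pair : measurable_fun [set: T * n.-tuple T] cons_pair.
Proof. exact: measurable_cons. Qed.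

(* The product measure mu \x nu, transported along T * T^n = T^(n+1). *)
Definition cons_measure : set (n.+1.-tuple T) -> \bar R :=
  pushforward (mu \x nu) cons_pair.

Let cons_measure0 : cons_measure set0 = 0.
Proof. by rewrite /cons_measure /pushforward preimage_set0 measure0. Qed.

Let cons_measure_ge0 A : 0 <= cons_measure A.
Proof. by rewrite /cons_measure /pushforward; exact: measure_ge0. Qed.

Let cons_measure_sigma_additive : semi_sigma_additive cons_measure.
Proof.
move=> F mF tF mUF; rewrite /cons_measure /pushforward preimage_bigcup.
have mp A : measurable A -> measurable (cons_pair @^-1` A).
  by move=> mA; rewrite -[X in measurable X]setTI; exact: measurable_cons_pair.
apply: measure_semi_sigma_additive.
- by move=> k; exact: mp.
- apply/trivIsetP => /= i j _ _ ij; rewrite -preimage_setI.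
  by move/trivIsetP : tF => /(_ _ _ _ _ ij) ->//; rewrite preimage_set0.
- by rewrite -preimage_bigcup; exact: mp.
Qed.

HB.instance Definition _ := isMeasure.Build _ _ _ cons_measure
  cons_measure0 cons_measure_ge0 cons_measure_sigma_additive.

Lemma cons_measureX A B : measurable A -> measurable B ->
  cons_measure [set t | A (thead t) /\ B [tuple of behead t]] = mu A * nu B.
Proof.
move=> mA mB; rewrite -product_measure1E// /cons_measure /pushforward.
congr ((mu \x nu) _); apply/seteqP; split => -[x t] /=; rewrite theadE;
  suff -> : [tuple of behead (cons_pair (x, t))] = t by [].
- exact: val_inj.
- exact: val_inj.
Qed.

Let cons_measure_sigma_finite : sigma_finite setT cons_measure.
Proof.
have /sigma_finiteP[F [TF ndF Foo]] := sigma_finiteT mu.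
have /sigma_finiteP[G [TG ndG Goo]] := sigma_finiteT nu.
exists (fun k => [set t | F k (thead t) /\ G k [tuple of behead t]]).
  rewrite predeqE => t; split => // _.
  have [i _ Fi] : (\bigcup_i F i) (thead t) by rewrite -TF.
  have [j _ Gj] : (\bigcup_i G i) [tuple of behead t] by rewrite -TG.
  exists (maxn i j) => //; split.
  - by move: Fi; exact/subsetPset/ndF/leq_maxl.
  - by move: Gj; exact/subsetPset/ndG/leq_maxr.
move=> k; have [mF Fk] := Foo k; have [mG Gk] := Goo k; split.
  apply: measurableI.
  - rewrite -[X in measurable X]setTI.
    exact: (@measurable_tnth _ T n.+1 ord0 measurableT _ mF).
  - rewrite -[X in measurable X]setTI.
    exact: (@measurable_behead _ T n measurableT _ mG).
by rewrite cons_measureX// lte_mul_pinfty// ge0_fin_numE.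
Qed.

HB.instance Definition _ := Measure_isSigmaFinite.Build _ _ _ cons_measure
  cons_measure_sigma_finite.

End cons_measure.

Section weighted_integral.
Context {R : realType}.
Local Notation mR := (measurableTypeR R).

(* Lebesgue measure on R^n (with its Borel sigma-algebra), points of R^n being
   n-tuples. *)
Fixpoint lebesgue_tuple (n : nat) :
    {sigma_finite_measure set (n.-tuple mR) -> \bar R} :=
  match n with
  | 0 => \d_ ([tuple] : 0.-tuple mR)
  | m.+1 => cons_measure lebesgue_measure (lebesgue_tuple m)
  end.

Lemma lebesgue_tuple_box n (A : 'I_n -> set mR) :
  (forall i, measurable (A i)) ->
  lebesgue_tuple n [set x | forall i, A i (tnth x i)] =
  (\prod_(i < n) lebesgue_measure (A i))%E.
Proof.
elim: n A => [|n IH] A mA.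
  by rewrite big_ord0 /= diracE mem_set//= => -[].
rewrite big_ord_recl -(IH (fun i => A (lift ord0 i)))//= -cons_measureX//=.
  congr (cons_measure _ _ _); apply/seteqP; split => t /=.
    move=> At; split => [|i]; first exact: At.
    by have := At (lift ord0 i); rewrite {1}(tuple_eta t) tnthS.
  move=> [A0 AS] i; have [->//|i0] := eqVneq i ord0.
  have [j ->] : exists j, i = lift ord0 j.
    by case: (unliftP ord0 i) i0 => [j -> _|->]; [exists j|rewrite eqxx].
  by rewrite (tuple_eta t) tnthS; exact: AS.
rewrite (_ : [set x | _] = \big[setI/setT]_(i < n)
    ((fun x : n.-tuple mR => tnth x i) @^-1` A (lift ord0 i))).
  apply: bigsetI_measurable => i _; rewrite -[X in measurable X]setTI.
  exact: (@measurable_tnth _ mR n i measurableT _ (mA _)).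
rewrite -bigcap_seq; apply/seteqP; split => t /= At i.
  by move=> _; exact: At.
by apply: At => /=; rewrite mem_index_enum.
Qed.

Definition lpnorm (p : R) (n : nat) (x : n.-tuple R) : R :=
  (\sum_(i < n) `|tnth x i| `^ p) `^ p^-1.

Definition density (beta : nat) (p : R) (n : nat) (x : n.-tuple R) : R :=
  expR (- (lpnorm p x `^ p)) *
  (\prod_(i < n) \prod_(j < n | (i < j)%N)
     `|tnth x i ^+ 2 - tnth x j ^+ 2| ^+ beta) *
  \prod_(i < n) `|tnth x i| ^+ (beta - 1).

(* M_{2, beta, beta-1, p}(F) *)
Definition Mint (beta : nat) (p : R) (n : nat) (F : n.-tuple R -> R) : R :=
  \int[lebesgue_tuple n]_x (F x * density beta p x).

(* M_p(F) / M_p(1) *)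
Definition Mmean (beta : nat) (p : R) (n : nat) (F : n.-tuple R -> R) : R :=
  Mint beta p F / Mint beta p (fun _ : n.-tuple R => 1).

Definition Mvar (beta : nat) (p : R) (n : nat) (G : n.-tuple R -> R) : R :=
  Mmean beta p (fun x => G x ^+ 2) - (Mmean beta p G) ^+ 2.

(* The mean of x_(k+1)^r; coordinates are numbered from 0, and a coordinate of
   index >= n is 0 by convention. *)
Definition Mmom (beta : nat) (p : R) (n k r : nat) : R :=
  Mmean beta p (fun x : n.-tuple R => x`_k ^+ r).

(* M_p(x_1^2 x_2^2) / M_p(1) - (M_p(x_1^2) / M_p(1))^2 *)
Definition cross_term (beta : nat) (p : R) (n : nat) : R :=
  Mmean beta p (fun x : n.-tuple R => x`_0 ^+ 2 * x`_1 ^+ 2) -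
  (Mmom beta p n 0 2) ^+ 2.

Definition Mvar_sqnorm (beta : nat) (p : R) (n : nat) : R :=
  Mvar beta p (fun x : n.-tuple R => lpnorm 2 x ^+ 2).

End weighted_integral.

(* Main.v *)
(* Write y_i = x_i^2, S = sum_i y_i, T = sum_i y_i^2 and let E be the mean for
   the density. Dilating one coordinate, x_i -> t x_i, and differentiating at
   t = 1 gives, for every test function G,
     p E[|x_i|^p G] = E[(beta + x_i d_i) G] + 2 beta E[sum_(k <> i) y_i G / (y_i - y_k)].
   For G = g(y_i, S), summing over i turns the singular terms into divided
   differences of y g(y, S).
   - g = (y - 2 S / n)^2: the left-hand side is nonnegative, and the right-hand
     side is an explicit combination of E[T] and E[S^2]. This yields
     n E[T] >= (3/2 - 13/n) E[S^2] >= (3/2 - 13/n) E[S]^2 with no information on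
     the concentration of S.
   - g = 1 and g = y give p E[sum |x_i|^p] = beta n^2 and
     p E[sum |x_i|^p y_i] = (2 beta n - beta + 2) E[S]; splitting at
     y_i ~ n^(2/p) they imply E[y_1] ~ n^(2/p) uniformly in p. *)
Require Import Defs.
From mathcomp Require Import all_boot all_order all_algebra all_fingroup.
From mathcomp Require Import all_classical all_reals all_analysis.
From mathcomp Require Import measurable_realfun ring lra.
Set Implicit Arguments.
Unset Strict Implicit.
Unset Printing Implicit Defensive.
Import Order.TTheory GRing.Theory Num.Theory.
Import numFieldNormedType.Exports.
Local Open Scope classical_set_scope.
Local Open Scope ring_scope.

(** * Lebesgue measure on tuples *)

Section tuple_measure.
Context {R : realType}.
Local Notation mR := (measurableTypeR R).
Local Notation leb := (@lebesgue_measure R).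
Local Notation lebn := (@lebesgue_tuple R).

(** Dilating a coordinate, instead of integrating by parts, leaves no boundary terms: t times the
    integral of F(t x_1, x_2, ...) does not depend on t > 0, and only its derivative at t = 1 is
    used. This matters because |x|^p and, for beta = 1, |x_i^2 - x_j^2| are not smooth. Off the null
    set where x_1^2 meets another x_j^2 the derivative exists, and a Lipschitz bound for t in [1, 2]
    permits dominated convergence, so the integrability of the singular terms is a conclusion and
    not an assumption. The family g = (y - l S)^2 gives, to leading order in n, 2 n E[T] >= (4 l n -
    (l n)^2 - 1) E[S^2]. The factor is largest at l n = 2, where it equals 3: this is the origin
    both of 2 S / n and of 3/2. Once E[y_1] is known to be of order n^(2/p), the part n Var(y_1) of
    Var(S) is at least of order n n^(4/p), so a smaller total can only come from negative cross
    terms. *)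

Lemma ge0_integral_lebesgue_tupleS n (f : n.+1.-tuple mR -> \bar R) :
  measurable_fun [set: n.+1.-tuple mR] f -> (forall x, (0 <= f x)%E) ->
  (\int[lebn n.+1]_x f x =
   \int[lebn n]_u \int[leb]_x f (cons_pair (x, u)))%E.
Proof.
move=> mf f0.
transitivity (\int[pushforward (leb \x lebn n) (@cons_pair _ mR n)]_x f x)%E.
  by [].
rewrite (ge0_integral_pushforward (@measurable_cons_pair _ mR n))//.
rewrite preimage_setT fubini_tonelli2//; last by move=> z; exact: f0.
apply: measurableT_comp => //; exact: measurable_cons_pair.
Qed.

Lemma measurable_lmul (t : R) : measurable_fun setT (fun x : mR => t * x : mR).
Proof. exact: mulrl_measurable. Qed.

(** The image of Lebesgue measure under x -> t x, multiplied by t, has the right value on half-open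
    intervals, so it is Lebesgue measure by uniqueness. *)
Lemma ge0_integral_lebesgue_scale (f : mR -> \bar R) (t : R) : 0 < t ->
  measurable_fun setT f -> (forall x, (0 <= f x)%E) ->
  (\int[leb]_x f x = t%:E * \int[leb]_x f (t * x)%R)%E.
Proof.
move=> t0 mf f0.
pose tn := NngNum (ltW t0).
pose m1 : {measure set mR -> \bar R} :=
  measure_function_pushforward__canonical__measure_function_Measure leb
    (measurable_lmul t).
pose M : {measure set mR -> \bar R} := mscale tn m1.
rewrite (@eq_measure_integral _ _ _ _ M).
  rewrite ge0_integral_mscale//; congr (_ * _)%E.
  rewrite (ge0_integral_pushforward (measurable_lmul t))//.
move=> A mA _; apply: lebesgue_measure_unique => // X [[a b] _ <-].
rewrite /M /= /mscale /= /pushforward /=.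
rewrite (_ : _ @^-1` _ = `]a / t, b / t]%classic); last first.
  apply/seteqP; split => x /=; rewrite !in_itv/= ltr_pdivrMr// ler_pdivlMr//;
  by rewrite ![t * _]mulrC.
rewrite !lebesgue_measure_itv /= !lte_fin ltr_pM2r ?invr_gt0//.
case: ifPn => ab; rewrite ?mule0//.
by rewrite -!EFinB -EFinM -mulrBl mulrCA divff ?mulr1// gt_eqF.
Qed.

(** * Invariance of Lebesgue measure under permutations of the coordinates *)

Definition perm_tuple T n (s : 'S_n) (x : n.-tuple T) : n.-tuple T :=
  [tuple tnth x (s i) | i < n].

Lemma tnth_perm_tuple T n (s : 'S_n) (x : n.-tuple T) i :
  tnth (perm_tuple s x) i = tnth x (s i).
Proof. by rewrite tnth_mktuple. Qed.

Lemma measurable_perm_tuple n (s : 'S_n) :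
  measurable_fun setT (@perm_tuple mR n s : n.-tuple mR -> n.-tuple mR).
Proof.
apply/measurable_fun_tnthP => i.
rewrite (_ : _ \o _ = (fun x : n.-tuple mR => tnth x (s i))).
  exact: measurable_tnth.
by apply/funext => x /=; rewrite tnth_perm_tuple.
Qed.

Lemma measurable_box n (A : 'I_n -> set mR) : (forall i, measurable (A i)) ->
  measurable [set x : n.-tuple mR | forall i, A i (tnth x i)].
Proof.
move=> mA; rewrite (_ : [set x | _] = \big[setI/setT]_(i < n)
    ((fun x : n.-tuple mR => tnth x i) @^-1` A i)).
  apply: bigsetI_measurable => i _; rewrite -[X in measurable X]setTI.
  exact: (@measurable_tnth _ mR n i measurableT _ (mA _)).
rewrite -bigcap_seq; apply/seteqP; split => t /= At i.
  by move=> _; exact: At.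
by apply: At => /=; rewrite mem_index_enum.
Qed.

(** [lebesgue_tuple] is built one coordinate at a time, so its symmetry is not visible from the
    definition. The measure and its image agree on boxes, which are stable under intersection,
    generate the sigma-algebra and contain the exhausting cubes [-k, k]^n of finite measure. *)
Lemma lebesgue_tuple_perm n (s : 'S_n) (A : set (n.-tuple mR)) :
  measurable A -> lebn n (@perm_tuple mR n s @^-1` A) = lebn n A.
Proof.
move=> mA.
pose m1 : {measure set (n.-tuple mR) -> \bar R} :=
  measure_function_pushforward__canonical__measure_function_Measure (lebn n)
    (measurable_perm_tuple s).
rewrite -[LHS]/(m1 A).
pose G := [set X | exists2 B : 'I_n -> set mR, (forall i, measurable (B i)) &
   X = [set x : n.-tuple mR | forall i, B i (tnth x i)]].
pose g (k : nat) := [set x : n.-tuple mR |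
  forall i, `[- k%:R, k%:R]%classic (tnth x i)].
have boxE X : G X -> m1 X = lebn n X.
  move=> [B mB ->]; rewrite /m1/= /pushforward [RHS]lebesgue_tuple_box//.
  rewrite (_ : _ @^-1` _ = [set x | forall i, B ((s^-1)%g i) (tnth x i)]).
    rewrite (lebesgue_tuple_box (A := fun i => B ((s^-1)%g i)))//.
    by rewrite (reindex_inj (@perm_inj _ s))/=; under eq_bigr do rewrite permK.
  apply/seteqP; split => x /= h i.
    by have := h ((s^-1)%g i); rewrite tnth_perm_tuple permKV.
  by have := h (s i); rewrite tnth_perm_tuple permK.
apply: (measure_unique G g) => //.
- apply/seteqP; split; last first.
    apply: smallest_sub; first exact: sigma_algebra_measurable.
    by move=> X [B mB ->]; exact: measurable_box.
  rewrite /measurable/=.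
  apply: smallest_sub; first exact: smallest_sigma_algebra.
  move=> X; rewrite -bigcup_seq/= => -[i _ [Y mY <-]].
  apply: sub_sigma_algebra; exists (fun j => if j == i then Y else setT).
    by move=> j; case: ifP.
  apply/seteqP; split => x /=; rewrite ?setTI.
    by move=> [_ Yx] j; case: ifPn => // /eqP ->.
  by move=> /(_ i); rewrite eqxx.
- move=> _ _ [B mB ->] [C mC ->]; exists (fun i => B i `&` C i).
    by move=> i; exact: measurableI.
  apply/seteqP; split => x /=.
    by move=> [h1 h2] i; split.
  by move=> h; split=> i; have [] := h i.
- by move=> k; exists (fun=> `[- k%:R, k%:R]%classic).
- apply/seteqP; split => // x _.
  have [k hk] : exists k : nat, forall i, `|tnth x i| <= k%:R.
    exists (\sum_(i < n) Num.bound `|tnth x i|)%N => i.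
    apply: le_trans (ltW (archi_boundP (normr_ge0 _))) _.
    by rewrite ler_nat (bigD1 i)//= leq_addr.
  by exists k => // i; rewrite /= in_itv/= -ler_norml; exact: hk.
- move=> k; rewrite boxE; last first.
    by exists (fun=> `[- k%:R, k%:R]%classic) => // i; exact: measurable_itv.
  pose B : set mR := `[- k%:R, k%:R]%classic.
  rewrite /g (@lebesgue_tuple_box _ n (fun=> B)); last by move=> ?; exact: measurable_itv.
  suff /andP[_ h] : (0 <= \prod_(i < n) leb B < +oo)%E by exact: h.
  apply: (big_ind (fun x => (0 <= x < +oo)%E)).
  - by rewrite lee01 ltry.
  - move=> x y /andP[x0 xoo] /andP[y0 yoo].
    rewrite mule_ge0//= lte_mul_pinfty//.
    by rewrite ge0_fin_numE.
  - move=> i _; rewrite measure_ge0/= lebesgue_measure_itv/=.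
    by case: ifP => _; rewrite ?ltry// -EFinB ltry.
Qed.

Lemma integral_lebesgue_tuple_perm n (s : 'S_n) (f : n.-tuple mR -> \bar R) :
  measurable_fun [set: n.-tuple mR] f ->
  (\int[lebn n]_x f (perm_tuple s x) = \int[lebn n]_x f x)%E.
Proof.
move=> mf.
have ge0 (g : n.-tuple mR -> \bar R) : measurable_fun [set: n.-tuple mR] g ->
    (forall x, 0 <= g x)%E ->
    (\int[lebn n]_x g (perm_tuple s x) = \int[lebn n]_x g x)%E.
  move=> mg g0; pose m1 : {measure set (n.-tuple mR) -> \bar R} :=
    measure_function_pushforward__canonical__measure_function_Measure (lebn n)
    (measurable_perm_tuple s).
  rewrite [RHS](eq_measure_integral m1); last first.
    by move=> A mA _; symmetry; exact: (lebesgue_tuple_perm s mA).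
  by rewrite (ge0_integral_pushforward (measurable_perm_tuple s)).
rewrite integralE [RHS]integralE; congr (_ - _)%E.
  rewrite (_ : (fun x => f (perm_tuple s x)) = f \o perm_tuple s)// funepos_comp.
  exact: (ge0 _ (measurable_funepos mf) (funepos_ge0 f)).
rewrite (_ : (fun x => f (perm_tuple s x)) = f \o perm_tuple s)// funeneg_comp.
exact: (ge0 _ (measurable_funeneg mf) (funeneg_ge0 f)).
Qed.

(** By Tonelli it is enough to look at a line on which the other coordinates u are fixed: the bad
    points there are among the finitely many u_j and -u_j. *)
Lemma null_coincide_sqr m :
  {ae lebn m.+1, forall x : m.+1.-tuple mR,
     forall j : 'I_m, tnth x ord0 ^+ 2 != tnth x (lift ord0 j) ^+ 2}.
Proof.
pose N := \bigcup_(j in [set: 'I_m]) [set x : m.+1.-tuple mR |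
   tnth x ord0 ^+ 2 - tnth x (lift ord0 j) ^+ 2 = 0].
have mN : measurable N.
  apply: countable_bigcupT_measurable => [|j]; first exact: countableP.
   rewrite -[X in measurable X]setTI.
  pose h (x : m.+1.-tuple mR) : R := tnth x ord0 ^+ 2 - tnth x (lift ord0 j) ^+ 2.
  have mh : measurable_fun [set: m.+1.-tuple mR] h.
    by apply: measurable_funB; apply: measurable_funX; exact: measurable_tnth.
  exact: (mh measurableT _ (measurable_set1 0)).
exists N; split => //; last first.
  move=> x /= /existsNP[j /negP]; rewrite negbK => /eqP e.
  by exists j => //=; rewrite e subrr.
rewrite -[N]setIT -integral_indic//.
have e : (\int[lebn m.+1]_x (\1_N x)%:E =
    \int[lebn m]_u \int[leb]_x (\1_N (cons_pair (x, u)))%:E)%E.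
  apply: (@ge0_integral_lebesgue_tupleS m (fun x => (\1_N x)%:E)).
  - exact/measurable_EFinP/measurable_indic.
  - by move=> x; rewrite lee_fin.
rewrite [LHS]e; apply: integral0_eq => u _.
pose B := [set x : mR | N (cons_pair (x, u))].
have cB : countable B.
  apply/finite_set_countable.
  apply: (@sub_finite_set _ _ [set` [seq tnth u j | j <- enum 'I_m] ++
                       [seq - tnth u j | j <- enum 'I_m]]); last first.
    exact: finite_seq.
  move=> x [j _ /=]; rewrite tnthS tnth0 => /eqP /=.
  rewrite subr_eq0 eqf_sqr mem_cat => /orP[] /eqP ->.
    by apply/orP; left; apply/mapP; exists j; rewrite ?mem_enum.
  by apply/orP; right; apply/mapP; exists j; rewrite ?mem_enum.
rewrite (_ : (\int[leb]_x _)%E = (\int[leb]_x (\1_B x)%:E)%E).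
  rewrite integral_indic// ?setIT; first exact: countable_lebesgue_measure0.
  exact: countable_measurable.
by apply: eq_integral => x _; rewrite !indicE.
Qed.

(** By Tonelli and induction the integral is the n-th power of the one-dimensional one. *)
Lemma integrable_prod_lebesgue_tuple (k : mR -> R) n :
  measurable_fun [set: mR] k -> (forall x, 0 <= k x) ->
  leb.-integrable setT (EFin \o k) ->
  (lebn n).-integrable setT (fun x => (\prod_(i < n) k (tnth x i))%:E).
Proof.
move=> mk k0 ik; have mp m : measurable_fun [set: m.-tuple mR]
    (fun x => \prod_(i < m) k (tnth x i)).
  apply: measurable_prod => i _; apply: measurableT_comp => //.
  exact: measurable_tnth.
have p0 m (x : m.-tuple mR) : 0 <= \prod_(i < m) k (tnth x i).
  by apply: prodr_ge0 => i _.
apply/integrableP; split; first by apply/measurable_EFinP; exact: mp.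
under eq_integral do rewrite gee0_abs ?lee_fin//.
have kE : (\int[leb]_x (k x)%:E)%E \is a fin_num.
  exact: integrable_fin_num.
suff -> : (\int[lebn n]_x (\prod_(i < n) k (tnth x i))%:E =
    (fine (\int[leb]_x (k x)%:E) ^+ n)%:E)%E by rewrite ltry.
elim: n => [|n IH].
  rewrite expr0 [LHS]integral_dirac//=; first by rewrite diracT mul1e big_ord0.
  by apply/measurable_EFinP; exact: mp.
apply: etrans.
  apply: (@ge0_integral_lebesgue_tupleS n
    (fun x => (\prod_(i < n.+1) k (tnth x i))%:E)).
  - by apply/measurable_EFinP; exact: mp.
  - by move=> x; rewrite lee_fin.
transitivity (\int[lebn n]_u ((fine (\int[leb]_x (k x)%:E))%:E *
    (\prod_(i < n) k (tnth u i))%:E))%E.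
  apply: eq_integral => u _; rewrite fineK//.
  rewrite -ge0_integralZr//; last 3 first.
  - exact/measurable_EFinP.
  - by move=> x _; rewrite lee_fin.
  - by rewrite lee_fin.
  apply: eq_integral => x _; rewrite big_ord_recl tnth0 -EFinM.
  by under eq_bigr do rewrite tnthS.
rewrite ge0_integralZl//; last 3 first.
- by apply/measurable_EFinP; exact: mp.
- by move=> x _; rewrite lee_fin.
- by rewrite lee_fin fine_ge0// integral_ge0// => x _; rewrite lee_fin.
by rewrite IH exprS EFinM.
Qed.

(** Evenness reduces this to the half-line, where the integrand is 1/a times the exponential density
    of rate a. *)
Lemma integrable_expR_normN (a : R) : 0 < a ->
  leb.-integrable setT (fun x => (expR (- (a * `|x|)))%:E).
Proof.
move=> a0.
have mf : measurable_fun [set: mR] (fun x : mR => expR (- (a * `|x|))).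
  apply: measurableT_comp => //; apply: measurableT_comp => //.
  by apply: measurableT_comp; [exact: mulrl_measurable|exact: normr_measurable].
apply/integrableP; split; first exact/measurable_EFinP.
under eq_integral do rewrite gee0_abs ?lee_fin ?expR_ge0//.
rewrite ge0_symfun_integralT; last 3 first.
- by move=> x; exact: expR_ge0.
- move=> x; apply: continuous_comp; last exact: continuous_expR.
  apply: (@continuousN _ R^o); apply: (@continuousM _ R^o).
    exact: cst_continuous.
  exact: norm_continuous.
- by move=> x /=; rewrite normrN.
apply: (@le_lt_trans _ _ (2%:E * (a^-1%:E *
   \int[leb]_x (exponential_pdf a x)%:E))%E); last first.
  by rewrite integral_exponential_pdf// mule1 -EFinM ltry.
rewrite lee_pmul2l ?lte_fin// -ge0_integralZl//; last 3 first.
- by apply/measurable_EFinP; exact: measurable_exponential_pdf.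
- by move=> x _; rewrite lee_fin exponential_pdf_ge0// ltW.
- by rewrite lee_fin invr_ge0 ltW.
rewrite [leLHS]integral_mkcond.
apply: (@ge0_le_integral _ mR R leb setT measurableT) => //.
- by move=> x _; apply: erestrict_ge0 => y _; rewrite lee_fin expR_ge0.
- apply/(measurable_restrictT _ _).1 => //.
    by rewrite -set_itvcy.
  by apply: measurable_funTS; exact/measurable_EFinP.
- apply: measurable_funeM; apply/measurable_EFinP; exact: measurable_exponential_pdf.
- move=> x _; rewrite /exponential_pdf !patchE.
  rewrite set_itvcy; case: ifPn => //= x0; last by rewrite mule0.
  move: x0; rewrite inE /= => x0.
  by rewrite -EFinM lee_fin mulKf ?gt_eqF// ger0_norm// mulNr.
Qed.
End tuple_measure.
(** * Polynomially bounded functions and the density *)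

Section weight.
Context {R : realType}.
Local Notation mR := (measurableTypeR R).
Local Notation leb := (@lebesgue_measure R).
Local Notation lebn := (@lebesgue_tuple R).

Definition powsum (p : R) n (x : n.-tuple R) : R := \sum_(i < n) `|tnth x i| `^ p.

(** Polynomial growth is measured by a product over the coordinates, so that integrability against
    exp(-powsum/2) splits into one-dimensional integrals. *)
Definition qprod n (x : n.-tuple R) : R := \prod_(i < n) (1 + tnth x i ^+ 2).

Lemma powsum_ge0 p n (x : n.-tuple R) : 0 <= powsum p x.
Proof. by apply: sumr_ge0 => i _; exact: powR_ge0. Qed.

Lemma qprod_ge1 n (x : n.-tuple R) : 1 <= qprod x.
Proof.
rewrite /qprod; elim/big_ind : _ => // [a b a1 b1|i _].
  by rewrite mulr_ege1.
by rewrite lerDl sqr_ge0.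
Qed.

Lemma qprod_ge0 n (x : n.-tuple R) : 0 <= qprod x.
Proof. exact: le_trans ler01 (qprod_ge1 x). Qed.

Lemma qprod_ge_sqr n (x : n.-tuple R) i : 1 + tnth x i ^+ 2 <= qprod x.
Proof.
rewrite /qprod (bigD1 i)//= ler_peMr//; first by rewrite addr_ge0// sqr_ge0.
elim/big_ind : _ => // [a b a1 b1|j _]; first by rewrite mulr_ege1.
by rewrite lerDl sqr_ge0.
Qed.

Lemma norm_le_qprod n (x : n.-tuple R) i : `|tnth x i| <= qprod x.
Proof.
apply: le_trans (qprod_ge_sqr x i); rewrite -(real_normK (num_real (tnth x i))).
by have := sqr_ge0 (`|tnth x i| - 1); have := normr_ge0 (tnth x i); nra.
Qed.

Lemma measurable_tnthR n i : measurable_fun [set: n.-tuple mR]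
  (fun x : n.-tuple mR => tnth x i : R).
Proof. exact: measurable_tnth. Qed.

Lemma measurable_powsum p n : measurable_fun [set: n.-tuple mR]
  (fun x : n.-tuple mR => powsum p (x : n.-tuple R)).
Proof.
apply: measurable_sum => i.
apply: (measurableT_comp (measurable_powR p)).
apply: measurableT_comp; [exact: normr_measurable|exact: measurable_tnthR].
Qed.

Lemma powR_ge_subr1 (p a : R) : 1 <= p -> 0 <= a -> a - 1 <= a `^ p.
Proof.
move=> p1 a0; have [a1|a1] := leP 1 a.
  by apply: le_trans (le1r_powR a1 p1); rewrite gerBl.
by apply: le_trans (powR_ge0 _ _); rewrite subr_le0 ltW.
Qed.

(** Since |x|^p >= |x| - 1 for p >= 1, the constant can be taken independent of p: half the exponent
    becomes |x|/2 up to a factor, and half of that absorbs the polynomial through a single term of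
    the exponential series. *)
Lemma poly_exp_bound (N : nat) : exists C : R, 0 <= C /\ forall (p x : R), 1 <= p ->
  (1 + x ^+ 2) ^+ N * expR (- (2^-1 * `|x| `^ p)) <= C * expR (- (4^-1 * `|x|)).
Proof.
pose M : R := 4 ^+ N.*2.+1 * (N.*2.+1)`!%:R.
have M0 : 0 <= M by rewrite mulr_ge0.
exists (M * expR 1); split; first by rewrite mulr_ge0 ?expR_ge0.
move=> p x p1; set a := `|x|; have a0 : 0 <= a by exact: normr_ge0.
have h1 : expR (- (2^-1 * a `^ p)) <= expR (2^-1) * expR (- (2^-1 * a)).
  rewrite -expRD ler_expR; have := powR_ge_subr1 p1 a0; lra.
have h2 : (1 + x ^+ 2) ^+ N <= (1 + a) ^+ N.*2.+1.
  apply: (@le_trans _ _ ((1 + a) ^+ N.*2)).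
    rewrite -mul2n exprM lerXn2r ?nnegrE ?addr_ge0 ?sqr_ge0//.
    by rewrite -(real_normK (num_real x)) -/a; nra.
  by rewrite exprSr ler_peMr ?exprn_ge0 ?addr_ge0 ?lerDl.
have h3 : (1 + a) ^+ N.*2.+1 <= M * expR (4^-1 * (1 + a)).
  have := @expR_ge1Dxn _ (4^-1 * (1 + a)) N.*2.
  rewrite mulr_ge0 ?addr_ge0// => /(_ isT) h.
  have {h} : (4^-1 * (1 + a)) ^+ N.*2.+1 / (N.*2.+1)`!%:R <= expR (4^-1 * (1 + a)).
    by apply: le_trans h; rewrite lerDr.
  rewrite ler_pdivrMr ?ltr0n ?fact_gt0// exprMn exprVn mulrC ler_pdivrMr ?exprn_gt0//.
  by move/le_trans; apply; rewrite /M; lra.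
have h4 : expR (4^-1 * (1 + a)) = expR (4^-1) * expR (4^-1 * a).
  by rewrite -expRD mulrDr mulr1.
apply: le_trans (ler_pM _ _ h2 h1) _; rewrite ?exprn_ge0 ?addr_ge0 ?sqr_ge0 ?expR_ge0//.
apply: le_trans (ler_wpM2r _ h3) _; first by rewrite mulr_ge0 ?expR_ge0.
rewrite -[leLHS]mulrA -[leRHS]mulrA (ler_wpM2l M0)//.
by rewrite -!expRD ler_expR; lra.
Qed.

Lemma integrable_qprod_exp p n N : 1 <= p -> (lebn n).-integrable setT
  (fun x : n.-tuple mR => (qprod (x : n.-tuple R) ^+ N * expR (- (2^-1 * powsum p (x
    : n.-tuple R))))%:E).
Proof.
move=> p1; have [C [C0 hC]] := poly_exp_bound N.
pose k (x : mR) : R := (1 + x ^+ 2) ^+ N * expR (- (2^-1 * `|x| `^ p)).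
have mk : measurable_fun [set: mR] k.
  apply: measurable_funM.
    by apply: measurable_funX; apply: measurable_funD => //; exact: measurable_funX.
  apply: measurableT_comp => //; apply: measurableT_comp => //.
  apply: measurable_funM => //; apply: (measurableT_comp (measurable_powR p)).
  exact: normr_measurable.
have k0 x : 0 <= k x.
  by rewrite mulr_ge0 ?expR_ge0// exprn_ge0// addr_ge0// sqr_ge0.
have ik : leb.-integrable setT (EFin \o k).
  apply: (@le_integrable _ _ _ leb _ measurableT _
      (fun x => (C%:E * (expR (- (4^-1 * `|x|)))%:E)%E)).
  - exact/measurable_EFinP.
  - move=> x _; rewrite /= (ger0_norm (k0 x)) ger0_norm ?mulr_ge0 ?expR_ge0//.
    by rewrite lee_fin; exact: hC.
  - by apply: integrableZl => //; exact: integrable_expR_normN.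
have := integrable_prod_lebesgue_tuple n mk k0 ik.
congr (integrable _ _ _); apply/funext => x; congr EFin.
by rewrite big_split/= prodrXl /powsum mulr_sumr -sumrN expR_sum.
Qed.

Definition tame n (F : n.-tuple mR -> R) :=
  measurable_fun [set: n.-tuple mR] F /\
  exists C N, 0 <= C /\ forall x, `|F x| <= C * qprod (x : n.-tuple R) ^+ N.

Lemma tame_cst n (c : R) : tame (fun _ : n.-tuple mR => c).
Proof.
split=> //; exists `|c|, 0%N; split=> // x.
by rewrite expr0 mulr1.
Qed.

Lemma tame_coord n i : tame (fun x : n.-tuple mR => tnth x i : R).
Proof.
split; first exact: measurable_tnthR.
exists 1, 1%N; split=> // x.
by rewrite expr1 mul1r norm_le_qprod.
Qed.

Lemma tameM n (F G : n.-tuple mR -> R) : tame F -> tame G ->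
  tame (fun x => F x * G x).
Proof.
move=> [mF [C [N [C0 hF]]]] [mG [D [M [D0 hG]]]]; split.
  exact: measurable_funM.
exists (C * D), (N + M)%N; split; first exact: mulr_ge0.
move=> x; rewrite normrM exprD mulrACA.
by rewrite ler_pM.
Qed.

Lemma tameD n (F G : n.-tuple mR -> R) : tame F -> tame G ->
  tame (fun x => F x + G x).
Proof.
move=> [mF [C [N [C0 hF]]]] [mG [D [M [D0 hG]]]]; split.
  exact: measurable_funD.
exists (C + D), (N + M)%N; split; first exact: addr_ge0.
move=> x; apply: le_trans (ler_normD _ _) _; rewrite mulrDl lerD//.
  apply: le_trans (hF x) _; rewrite ler_wpM2l// ler_weXn2l ?qprod_ge1// leq_addr.
by [].
apply: le_trans (hG x) _; rewrite ler_wpM2l// ler_weXn2l ?qprod_ge1// leq_addl.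
by [].
Qed.

Lemma tameN n (F : n.-tuple mR -> R) : tame F -> tame (fun x => - F x).
Proof.
move=> hF; rewrite (_ : (fun x => _) = fun x => -1 * F x).
  by apply: tameM => //; exact: tame_cst.
by apply/funext => x; rewrite mulN1r.
Qed.

Lemma tameB n (F G : n.-tuple mR -> R) : tame F -> tame G ->
  tame (fun x => F x - G x).
Proof. by move=> hF hG; apply: tameD => //; exact: tameN. Qed.

Lemma tameX n (F : n.-tuple mR -> R) k : tame F -> tame (fun x => F x ^+ k).
Proof.
move=> hF; elim: k => [|k IH].
  rewrite (_ : (fun x => _) = fun x => 1); first exact: tame_cst.
  by apply/funext.
rewrite (_ : (fun x => _) = fun x => F x * F x ^+ k); first exact: tameM.
by apply/funext => x; rewrite exprS.
Qed.

Lemma tame_norm n (F : n.-tuple mR -> R) : tame F -> tame (fun x => `|F x|).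
Proof.
move=> [mF [C [N [C0 hF]]]]; split.
  by apply: measurableT_comp => //; exact: normr_measurable.
by exists C, N; split=> // x; rewrite normr_id.
Qed.

Lemma tame_sum n (I : Type) (r : seq I) (P : pred I) (F : I -> n.-tuple mR -> R) :
  (forall i, P i -> tame (F i)) -> tame (fun x => \sum_(i <- r | P i) F i x).
Proof.
move=> hF; elim: r => [|i r IH].
  rewrite (_ : (fun x => _) = fun x => 0); first exact: tame_cst.
  by apply/funext => x; rewrite big_nil.
rewrite (_ : (fun x => _) = fun x => (if P i then F i x else 0) + \sum_(i <- r | P i)
  F i x).
  by apply: tameD => //; case Pi : (P i); [exact: hF|exact: tame_cst].
by apply/funext => x; rewrite big_cons; case: ifP; rewrite ?add0r.
Qed.

Lemma tame_prod n (I : Type) (r : seq I) (P : pred I) (F : I -> n.-tuple mR -> R) :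
  (forall i, P i -> tame (F i)) -> tame (fun x => \prod_(i <- r | P i) F i x).
Proof.
move=> hF; elim: r => [|i r IH].
  rewrite (_ : (fun x => _) = fun x => 1); first exact: tame_cst.
  by apply/funext => x; rewrite big_nil.
rewrite (_ : (fun x => _) = fun x => (if P i then F i x else 1) * \prod_(i <- r | P
  i) F i x).
  by apply: tameM => //; case Pi : (P i); [exact: hF|exact: tame_cst].
by apply/funext => x; rewrite big_cons; case: ifP; rewrite ?mul1r.
Qed.

Definition vandermonde beta n (x : n.-tuple R) : R :=
  (\prod_(i < n) \prod_(j < n | (i < j)%N)
     `|tnth x i ^+ 2 - tnth x j ^+ 2| ^+ beta) *
  \prod_(i < n) `|tnth x i| ^+ (beta - 1).

Lemma vandermonde_ge0 beta n (x : n.-tuple R) : 0 <= vandermonde beta x.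
Proof.
apply: mulr_ge0; apply: prodr_ge0 => i _; last exact: exprn_ge0.
by apply: prodr_ge0 => j _; exact: exprn_ge0.
Qed.

Lemma tame_vandermonde beta n :
  tame (fun x : n.-tuple mR => vandermonde beta (x : n.-tuple R)).
Proof.
apply: tameM; apply: tame_prod => i _.
  apply: tame_prod => j _; apply: tameX; apply: tame_norm.
  by apply: tameB; apply: tameX; exact: tame_coord.
by apply: tameX; apply: tame_norm; exact: tame_coord.
Qed.

Lemma densityE beta p n (x : n.-tuple R) : 1 <= p ->
  density beta p x = expR (- powsum p x) * vandermonde beta x.
Proof.
move=> p1; rewrite /density /lpnorm -/(powsum p x) -powRrM mulVf ?gt_eqF//; last first.
  by rewrite (lt_le_trans ltr01).
by rewrite powRr1 ?powsum_ge0// -mulrA.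
Qed.

Lemma density_ge0 beta p n (x : n.-tuple R) : 0 <= density beta p x.
Proof.
by rewrite /density -mulrA mulr_ge0 ?expR_ge0 ?(vandermonde_ge0 beta x).
Qed.

Lemma measurable_density beta p n : 1 <= p -> measurable_fun [set: n.-tuple mR]
  (fun x : n.-tuple mR => density beta p (x : n.-tuple R)).
Proof.
move=> p1; rewrite (_ : (fun x => _) =
   fun x : n.-tuple mR => expR (- powsum p (x : n.-tuple R)) * vandermonde beta (x :
     n.-tuple R)).
  apply: measurable_funM; last by have [] := tame_vandermonde beta n.
  by apply: measurableT_comp => //; apply: measurableT_comp => //; exact:
    measurable_powsum.
by apply/funext => x; exact: densityE.
Qed.

(** Half of the exponent suffices for integrability; the other half remains available to absorb
    factors such as |x_i|^p. *)
Lemma integrable_tame_exp p n (F G : n.-tuple mR -> R) : 1 <= p ->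
  measurable_fun [set: n.-tuple mR] F -> tame G ->
  (forall x, `|F x| <= `|G x| * expR (- (2^-1 * powsum p (x : n.-tuple R)))) ->
  (lebn n).-integrable setT (EFin \o F).
Proof.
move=> p1 mF [mG [C [N [C0 hG]]]] FG.
apply: (@le_integrable _ _ _ (lebn n) _ measurableT _
  (fun x => (C%:E * (qprod (x : n.-tuple R) ^+ N * expR (- (2^-1 * powsum p (x :
    n.-tuple R))))%:E)%E)).
- exact/measurable_EFinP.
- move=> x _; rewrite -EFinM !abse_EFin lee_fin.
  rewrite (ger0_norm (_ : 0 <= C * _)); last first.
    by rewrite !mulr_ge0 ?expR_ge0// exprn_ge0// qprod_ge0.
  apply: le_trans (FG x) _; rewrite mulrA ler_wpM2r ?expR_ge0//.
- by apply: integrableZl => //; exact: integrable_qprod_exp.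
Qed.

End weight.
(** * Differentiating along dilations of the first coordinate *)

Section dilation.
Context {R : realType}.
Local Notation mR := (measurableTypeR R).
Local Notation lebn := (@lebesgue_tuple R).

(** Only the first coordinate is dilated; the others are reached later by transposing
    coordinates. *)
Definition scale0 (t : R) m (x : m.+1.-tuple R) : m.+1.-tuple R :=
  [tuple of t * thead x :: behead x].

Lemma scale01 m (x : m.+1.-tuple R) : scale0 1 x = x.
Proof. by rewrite {2}(tuple_eta x) /scale0 mul1r. Qed.

Lemma tnth_scale0_0 t m (x : m.+1.-tuple R) :
  tnth (scale0 t x) ord0 = t * tnth x ord0.
Proof. by rewrite /scale0 tnth0. Qed.

Lemma tnth_scale0_lift t m (x : m.+1.-tuple R) j :
  tnth (scale0 t x) (lift ord0 j) = tnth x (lift ord0 j).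
Proof. by rewrite [in RHS](tuple_eta x) /scale0 !tnthS. Qed.

Lemma tnth_behead_lift m (x : m.+1.-tuple R) j :
  tnth [tuple of behead x] j = tnth x (lift ord0 j).
Proof. by rewrite [in RHS](tuple_eta x) tnthS. Qed.

Lemma behead_scale0 t m (x : m.+1.-tuple R) :
  [tuple of behead (scale0 t x)] = [tuple of behead x].
Proof. by apply: val_inj. Qed.

Lemma measurable_scale0 t m : measurable_fun [set: m.+1.-tuple mR]
  (@scale0 t m : m.+1.-tuple mR -> m.+1.-tuple mR).
Proof.
apply/measurable_fun_tnthP => i; have [j ->|->] := unliftP ord0 i.
  rewrite (_ : _ \o _ = fun x : m.+1.-tuple mR => tnth x (lift ord0 j)).
    exact: measurable_tnth.
  by apply/funext => x /=; rewrite tnth_scale0_lift.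
rewrite (_ : _ \o _ = fun x : m.+1.-tuple mR => t * tnth x ord0).
  by apply: measurableT_comp; [exact: mulrl_measurable|exact: measurable_tnth].
by apply/funext => x /=; rewrite tnth_scale0_0.
Qed.

Lemma integral_scale0 m (f : m.+1.-tuple mR -> \bar R) t : 0 < t ->
  measurable_fun [set: m.+1.-tuple mR] f -> (forall x, (0 <= f x)%E) ->
  (\int[lebn m.+1]_x (t%:E * f (scale0 t x)) = \int[lebn m.+1]_x f x)%E.
Proof.
move=> t0 mf f0.
have mft : measurable_fun [set: m.+1.-tuple mR] (fun x => t%:E * f (scale0 t x))%E.
  apply: measurable_funeM; apply: (measurableT_comp mf).
  exact: measurable_scale0.
have ft0 x : (0 <= t%:E * f (scale0 t x))%E by rewrite mule_ge0// lee_fin ltW.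
apply: etrans; first exact: (ge0_integral_lebesgue_tupleS mft ft0).
apply: etrans; last by symmetry; exact: (ge0_integral_lebesgue_tupleS mf f0).
apply: eq_integral => u _.
have mu : measurable_fun [set: mR] (fun x => f (cons_pair (x, u))).
  apply: (measurableT_comp mf).
  apply: (measurableT_comp (@measurable_cons_pair _ mR m)).
  exact: pair2_measurable.
rewrite (ge0_integral_lebesgue_scale t0 mu)// -ge0_integralZl//; last 2 first.
- apply: (measurableT_comp mu); exact: measurable_lmul.
- by rewrite lee_fin ltW.
by apply: eq_integral => x _; congr (_ * f _)%E; apply: val_inj.
Qed.

(** Dominated convergence works along sequences, so the derivative at 1 is read along the steps
    1/(k+1). *)
Lemma is_derive_seq (phi : R -> R) d : is_derive (1 : R) (1 : R) phi d ->
  k.+1%:R * (phi (1 + k.+1%:R^-1) - phi 1) @[k --> \oo] --> (d : R).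
Proof.
move=> [/cvg_ex[l hl] e].
have {hl e} h : h^-1 *: (phi (h *: 1 + 1) - phi 1) @[h --> 0^'] --> (d : R).
  by rewrite -e /derive; apply/cvg_ex; exists l.
have /cvgr_dnbhsP/(_ (@harmonic R)) := h.
have hp : (forall n, @harmonic R n != 0) /\ @harmonic R n @[n --> \oo] --> (0 : R).
  by split; [move=> n; rewrite gt_eqF// harmonic_gt0|exact: cvg_harmonic].
move=> /(_ hp); apply: cvg_trans; apply: near_eq_cvg; apply: nearW => k /=.
rewrite /harmonic invrK -[k.+1%:R^-1%:A]/(k.+1%:R^-1 * 1 : R) mulr1.
by rewrite [1 + _]addrC.
Qed.

(** The integral of t f(scale0 t x) is constant in t, so every difference quotient at 1 has integral
    0, and so does their limit. The steps 1/(k+1) stay within [0, 1], whence a domination for t in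
    [1, 2] only. *)
Lemma dilation_derivative m (f Lf g : m.+1.-tuple mR -> R) :
  measurable_fun [set: m.+1.-tuple mR] f -> (forall x, 0 <= f x) ->
  (lebn m.+1).-integrable setT (EFin \o f) ->
  measurable_fun [set: m.+1.-tuple mR] Lf ->
  (lebn m.+1).-integrable setT (EFin \o g) ->
  (forall x t, 1 <= t -> t <= 2 ->
     `|t * f (scale0 t x) - f x| <= (t - 1) * g x) ->
  {ae lebn m.+1, forall x,
     is_derive (1 : R) (1 : R) (fun t => t * f (scale0 t x)) (Lf x)} ->
  (lebn m.+1).-integrable setT (EFin \o Lf) /\
  (\int[lebn m.+1]_x (Lf x)%:E = 0)%E.
Proof.
move=> mf f0 intf mL intg dom der.
pose t_ (k : nat) : R := 1 + k.+1%:R^-1.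
have t1 k : 1 <= t_ k by rewrite lerDl invr_ge0.
have t0 k : 0 < t_ k by exact: lt_le_trans (t1 k).
have t2 k : t_ k <= 2 by rewrite /t_ lerD2l invf_le1// ler1n.
pose h_ (k : nat) (x : m.+1.-tuple mR) : R := t_ k * f (scale0 (t_ k) x).
pose f_ (k : nat) (x : m.+1.-tuple mR) : R := k.+1%:R * (h_ k x - f x).
have mh k : measurable_fun [set: m.+1.-tuple mR] (h_ k).
  apply: measurable_funM => //; apply: (measurableT_comp mf).
  exact: measurable_scale0.
have hE k : (\int[lebn m.+1]_x (h_ k x)%:E = \int[lebn m.+1]_x (f x)%:E)%E.
  apply: etrans; last first.
    apply: (integral_scale0 (t0 k) (f := EFin \o f)).
    - exact/measurable_EFinP.
    - by move=> x; rewrite lee_fin.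
  by apply: eq_integral => x _; rewrite EFinM.
have ih k : (lebn m.+1).-integrable setT (EFin \o h_ k).
  apply/integrableP; split; first exact/measurable_EFinP.
  under eq_integral => x _.
    rewrite /= ger0_norm; last by rewrite mulr_ge0// ltW.
    over.
  rewrite hE; move/integrableP : intf => [_].
  by under eq_integral => x _ do rewrite /= ger0_norm//.
have f_0 k : (\int[lebn m.+1]_x (f_ k x)%:E = 0)%E.
  under eq_integral do rewrite EFinM EFinB.
  rewrite integralZl//; last exact: (integrableB measurableT (ih k) intf).
  rewrite (integralB measurableT (ih k) intf) [X in (_ * (X - _))%E]hE subee ?mule0//.
  exact: integrable_fin_num.
have mf_ k : measurable_fun [set: m.+1.-tuple mR] (EFin \o f_ k).
  by apply/measurable_EFinP; apply: measurable_funM => //; exact: measurable_funB.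
have := dominated_convergence (mu := lebn m.+1) measurableT
  (f_ := fun k x => (f_ k x)%:E) (f := EFin \o Lf) (g := EFin \o g) mf_.
case.
- exact/measurable_EFinP.
- move: der => [N [mN N0 sub]]; exists N; split=> // x nx; apply: sub => dx.
  apply: nx => _; apply: cvg_EFin; first exact: nearW.
  have := is_derive_seq dx.
  by rewrite scale01 mul1r.
- exact: intg.
- apply: aeW => x k _; rewrite lee_fin /f_ normrM ger0_norm//.
  rewrite mulrC -ler_pdivlMr ?ltr0n//.
  apply: le_trans (dom x _ (t1 k) (t2 k)) _.
  by rewrite /t_ addrAC subrr add0r mulrC.
move=> iL _ cL; split=> //.
apply/esym; move: cL.
rewrite (_ : [sequence _]_n = fun=> 0%E); last first.
  by apply/funext => k /=; exact: f_0.
by move/cvg_lim => <-//; rewrite lim_cst.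
Qed.

End dilation.

(** * The dilation identity for the density *)

Section ibp.
Context {R : realType}.
Local Notation mR := (measurableTypeR R).
Local Notation lebn := (@lebesgue_tuple R).

(* The bound c carries the size of phi, which will depend on the point x, while
   K does not: constants K add up under products. *)
Definition rlip12 (phi : R -> R) (c K : R) := [/\ 0 <= c, 0 <= K &
  forall t, 1 <= t -> t <= 2 ->
    `|phi t| <= c /\ `|phi t - phi 1| <= K * c * (t - 1)].

Lemma rlip12_cst a : rlip12 (fun=> a) `|a| 0.
Proof. by split=> // t t1 t2; rewrite subrr normr0 !mul0r. Qed.

Lemma rlip12_id : rlip12 id 2 1.
Proof.
split=> // t t1 t2; rewrite !ger0_norm ?subr_ge0//; first by split=> //; lra.
by rewrite (le_trans ler01).
Qed.

Lemma rlip12M phi psi c d K L : rlip12 phi c K -> rlip12 psi d L ->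
  rlip12 (fun t => phi t * psi t) (c * d) (K + L).
Proof.
move=> [c0 K0 h] [d0 L0 g]; split; rewrite ?mulr_ge0 ?addr_ge0// => t t1 t2.
have [h1 h2] := h _ t1 t2; have [g1 g2] := g _ t1 t2.
have [h3 _] := h 1 (lexx _) (ltW (ltr1n R 2)).
split; first by rewrite normrM ler_pM.
rewrite (_ : _ - _ = (phi t - phi 1) * psi t + phi 1 * (psi t - psi 1)); last by ring.
apply: le_trans (ler_normD _ _) _; rewrite !normrM.
rewrite (_ : (K + L) * _ * _ = K * c * (t - 1) * d + c * (L * d * (t - 1))); last by ring.
by rewrite lerD// ler_pM.
Qed.

Lemma rlip12X phi c K n : rlip12 phi c K ->
  rlip12 (fun t => phi t ^+ n) (c ^+ n) (n%:R * K).
Proof.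
move=> h; elim: n => [|n IH].
  rewrite mul0r expr0 (_ : (fun t => _) = fun=> 1).
    by rewrite -[X in rlip12 _ X _]normr1; exact: rlip12_cst.
  by apply/funext.
rewrite exprS -addn1 natrD mulrDl mul1r [_ + K]addrC.
rewrite (_ : (fun t => _) = fun t => phi t * phi t ^+ n); first exact: rlip12M.
by apply/funext => t; rewrite addn1 exprS.
Qed.

Lemma rlip12_norm phi c K : rlip12 phi c K -> rlip12 (fun t => `|phi t|) c K.
Proof.
move=> [c0 K0 h]; split=> // t t1 t2; have [h1 h2] := h _ t1 t2.
by rewrite normr_id; split=> //; apply: le_trans h2; exact: ler_dist_dist.
Qed.

Lemma rlip12_prod (I : Type) (r : seq I) (phi : I -> R -> R) (c : I -> R) K :
  (forall i, rlip12 (phi i) (c i) K) ->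
  rlip12 (fun t => \prod_(i <- r) phi i t) (\prod_(i <- r) c i) ((size r)%:R * K).
Proof.
move=> h; elim: r => [|i r IH].
  rewrite mul0r big_nil (_ : (fun t => _) = fun=> 1).
    by rewrite -[X in rlip12 _ X _]normr1; exact: rlip12_cst.
  by apply/funext => t; rewrite big_nil.
rewrite big_cons /= -addn1 natrD mulrDl mul1r [_ + K]addrC.
rewrite (_ : (fun t => _) = fun t => phi i t * \prod_(i <- r) phi i t).
  exact: rlip12M.
by apply/funext => t; rewrite big_cons.
Qed.

(** The size bound 4 a + b also dominates the increment, because (t^2 - 1) a <= 3 a (t - 1) on
    [1, 2]. *)
Lemma rlip12_quad a b : 0 <= a -> 0 <= b ->
  rlip12 (fun t => t ^+ 2 * a - b) (4 * a + b) 1.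
Proof.
move=> a0 b0; split; rewrite ?addr_ge0 ?mulr_ge0// => t t1 t2; split.
  have ta0 : 0 <= t ^+ 2 * a by rewrite mulr_ge0 ?sqr_ge0.
  have ta4 : t ^+ 2 * a <= 4 * a by rewrite ler_wpM2r//; nra.
  by rewrite ler_norml; apply/andP; split; lra.
rewrite expr1n mul1r (_ : _ - _ = (t - 1) * ((t + 1) * a)); last by ring.
rewrite normrM ger0_norm ?subr_ge0// mul1r [leRHS]mulrC ler_wpM2l ?subr_ge0//.
rewrite ger0_norm ?mulr_ge0//; last by lra.
by nra.
Qed.

(** [K] is uniform in u: the increment is at most exp(-u) (t^p - 1) u, and the factor 1 + u in the
    size bound pays for this u. A natural number N >= p reduces t^p - 1 to t^N - 1. *)
Lemma rlip12_expR_powR p : 0 <= p -> exists K, forall u, 0 <= u ->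
  rlip12 (fun t => expR (- (t `^ p * u))) ((1 + u) * expR (- u)) K.
Proof.
move=> p0; pose N := Num.bound p.
have pN : p <= N%:R by exact/ltW/archi_boundP.
have [_ K0 hN] := rlip12X N rlip12_id.
exists (N%:R * 1 * 2 ^+ N) => u u0; split.
- by rewrite mulr_ge0 ?expR_ge0 ?addr_ge0.
- by rewrite mulr_ge0.
move=> t t1 t2; have t0 : 0 <= t by exact: le_trans t1.
have tp1 : 1 <= t `^ p.
  by have := @ge0_ler_powR R p p0 1 t; rewrite !nnegrE powR1 => /(_ ler01 t0 t1).
have tpN : t `^ p - 1 <= N%:R * 1 * 2 ^+ N * (t - 1).
  have [_] := hN t t1 t2; rewrite expr1n => /(le_trans (ler_norm _)).
  apply: le_trans; rewrite lerB// -powR_mulrn//; exact: ler_powR.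
have e1 : expR (- (t `^ p * u)) <= expR (- u).
  by rewrite ler_expR lerN2 ler_peMl.
have eu0 := expR_ge0 (- u).
rewrite powR1 mul1r; split.
  by rewrite ger0_norm ?expR_ge0// (le_trans e1)// ler_peMl// lerDl.
rewrite distrC ger0_norm ?subr_ge0//.
have -> : expR (- (t `^ p * u)) = expR (- u) * expR (- ((t `^ p - 1) * u)).
  by rewrite -expRD; congr expR; ring.
have h := expR_ge1Dx (- ((t `^ p - 1) * u)).
set K := N%:R * 1 * 2 ^+ N * (t - 1) in tpN *.
apply: (@le_trans _ _ (expR (- u) * ((t `^ p - 1) * u))).
  by rewrite -[X in X - _]mulr1 -mulrBr ler_wpM2l//; lra.
rewrite (_ : N%:R * 1 * 2 ^+ N * _ * (t - 1) = expR (- u) * (K * (1 + u))); last first.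
  by rewrite /K; ring.
rewrite ler_wpM2l//; have K_ge0 : 0 <= K by rewrite (le_trans _ tpN)// subr_ge0.
apply: (@le_trans _ _ (K * u)); first by rewrite ler_wpM2r.
by rewrite ler_wpM2l// lerDr.
Qed.

Lemma is_derive1M (phi psi : R -> R) d e :
  is_derive (1 : R) (1 : R) phi d -> is_derive (1 : R) (1 : R) psi e ->
  is_derive (1 : R) (1 : R) (fun t => phi t * psi t) (d * psi 1 + phi 1 * e).
Proof.
move=> h g; apply: (is_derive_eq (is_deriveM h g)).
by rewrite addrC; congr (_ + _); exact: mulrC.
Qed.

(** Derivatives at 1 are carried in the form phi(1) l, with l the logarithmic derivative, so that
    products of factors turn into sums of the l. *)
Lemma is_derive1_logX (phi : R -> R) l n :
  is_derive (1 : R) (1 : R) phi (phi 1 * l) ->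
  is_derive (1 : R) (1 : R) (fun t => phi t ^+ n) (phi 1 ^+ n * (n%:R * l)).
Proof.
move=> h; elim: n => [|n IH].
  rewrite mul0r mulr0; apply: (is_derive_eq (is_derive_cst _ _ _)) => //.
rewrite (_ : (fun t => _) = fun t => phi t * phi t ^+ n).
  apply: (is_derive_eq (is_derive1M h IH)).
  by rewrite exprS -natr1; ring.
by apply/funext => t; rewrite exprS.
Qed.

Lemma is_derive1_log_prod (I : Type) (r : seq I) (phi : I -> R -> R) (l : I -> R) :
  (forall i, is_derive (1 : R) (1 : R) (phi i) (phi i 1 * l i)) ->
  is_derive (1 : R) (1 : R) (fun t => \prod_(i <- r) phi i t)
    (\prod_(i <- r) phi i 1 * \sum_(i <- r) l i).
Proof.
move=> h; elim: r => [|i r IH].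
  rewrite !big_nil mulr0 (_ : (fun t => _) = fun=> 1).
    exact: is_derive_cst.
  by apply/funext => t; rewrite big_nil.
rewrite (_ : (fun t => _) = fun t => phi i t * \prod_(i <- r) phi i t).
  apply: (is_derive_eq (is_derive1M (h i) IH)).
  by rewrite !big_cons; ring.
by apply/funext => t; rewrite big_cons.
Qed.

Lemma is_derive1_quad (a b : R) :
  is_derive (1 : R) (1 : R) (fun t => t ^+ 2 * a - b) (2 * a).
Proof.
have -> : (fun t : R => t ^+ 2 * a - b) = (fun t => (t * t) * a + (- b)).
  by apply/funext => t; rewrite expr2.
have h := is_derive1M (is_derive_id (1 : R) (1 : R)) (is_derive_id (1 : R) (1 : R)).
have g := is_derive1M h (is_derive_cst a (1 : R) (1 : R)).
apply: (is_derive_eq (is_deriveD g (is_derive_cst (- b) (1 : R) (1 : R)))).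
by rewrite /=; ring.
Qed.

(** Near t = 1 the sign of t^2 a - b is that of a - b, so the norm is locally a signed
    polynomial. *)
Lemma is_derive1_norm_quad (a b : R) : a != b ->
  is_derive (1 : R) (1 : R) (fun t => `|t ^+ 2 * a - b|)
    (`|1 ^+ 2 * a - b| * (2 * a / (a - b))).
Proof.
move=> ab; have ab0 : a - b != 0 by rewrite subr_eq0.
have h := is_derive1M (is_derive_cst (Num.sg (a - b)) (1 : R) (1 : R))
  (is_derive1_quad a b).
have h' : is_derive (1 : R) (1 : R) (fun t => Num.sg (a - b) * (t ^+ 2 * a - b))
    (`|1 ^+ 2 * a - b| * (2 * a / (a - b))).
  apply: (is_derive_eq h).
  rewrite /cst expr1n mul1r mul0r add0r normrEsg.
  by field.
apply: (near_eq_is_derive _ h').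
have c : {for (1 : R), continuous (fun t : R => t ^+ 2 * a - b)}.
  by apply: differentiable_continuous; apply/derivable1_diffP; case: (is_derive1_quad
    a b).
have ab1 : 0 < `|a - b| by rewrite normr_gt0.
have := @cvgr_dist_lt _ _ _ _ _ _ _ c _ ab1; move=> /(_ (nbhs_filter (1 : R))).
apply: filterS => t /=; rewrite expr1n mul1r.
have [ab2|ab2|ab2] := ltgtP 0 (a - b); last by rewrite -ab2 eqxx in ab0.
  rewrite gtr0_sg// mul1r (gtr0_norm ab2) ltr_norml => /andP[_ h2].
  by rewrite ger0_norm//; lra.
rewrite ltr0_sg// mulN1r (ltr0_norm ab2) ltr_norml => /andP[h2 _].
by rewrite ler0_norm//; lra.
Qed.

Lemma is_derive1_expR_powR (p u : R) :
  is_derive (1 : R) (1 : R) (fun t => expR (- (t `^ p * u)))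
    (- (p * u) * expR (- u)).
Proof.
have h := is_derive1_powR p (@ltr01 R).
have g := is_derive1M h (is_derive_cst (- u) (1 : R) (1 : R)).
have k := is_derive_expR ((1 : R) `^ p * - u).
have -> : (fun t : R => expR (- (t `^ p * u))) =
    expR \o (fun t : R => t `^ p * - u).
  by apply/funext => t /=; rewrite mulrN.
have c := @is_derive1_comp R expR (fun t : R => t `^ p * - u) 1 _ _ k g.
by apply: (is_derive_eq c); rewrite /cst !powR1 mul1r; ring.
Qed.

(** The inverse is f times the square of |f|^(-1), the latter being a measurable power; at f = 0
    both sides are 0, since the inverse of 0 is 0 by convention. *)
Lemma measurable_invR d (T : measurableType d) (f : T -> R) :
  measurable_fun setT f -> measurable_fun setT (fun x => (f x)^-1).
Proof.
move=> mf; rewrite (_ : (fun x => _) = fun x => f x * (`|f x| `^ (-1)) ^+ 2).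
  apply: measurable_funM => //; apply: measurable_funX.
  apply: (measurableT_comp (measurable_powR (-1))).
  by apply: measurableT_comp => //; exact: normr_measurable.
apply/funext => x; rewrite powR_inv1// exprVn real_normK ?num_real//.
have [->|fx] := eqVneq (f x) 0; first by rewrite invr0 mul0r.
by field.
Qed.

Lemma vandermonde_split beta m (x : m.+1.-tuple R) :
  vandermonde beta x = `|tnth x ord0| ^+ (beta - 1) *
    (\prod_(j < m) `|tnth x ord0 ^+ 2 - tnth x (lift ord0 j) ^+ 2|) ^+ beta *
    vandermonde beta [tuple of behead x].
Proof.
rewrite /vandermonde big_ord_recl [X in _ * X]big_ord_recl /=.
have -> : \prod_(j < m.+1 | (0 < j)%N) `|tnth x ord0 ^+ 2 - tnth x j ^+ 2| ^+ beta =
    (\prod_(j < m) `|tnth x ord0 ^+ 2 - tnth x (lift ord0 j) ^+ 2|) ^+ beta.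
  by rewrite big_mkcond big_ord_recl/= mul1r -prodrXl.
have -> : \prod_(i < m) \prod_(j < m.+1 | (lift ord0 i < j)%N)
     `|tnth x (lift ord0 i) ^+ 2 - tnth x j ^+ 2| ^+ beta =
   \prod_(i < m) \prod_(j < m | (i < j)%N)
     `|tnth [tuple of behead x] i ^+ 2 - tnth [tuple of behead x] j ^+ 2| ^+ beta.
  apply: eq_bigr => i _; rewrite big_mkcond big_ord_recl/= mul1r [RHS]big_mkcond/=.
  by apply: eq_bigr => j _; rewrite !tnth_behead_lift /bump !add1n ltnS.
have -> : \prod_(i < m) `|tnth [tuple of behead x] i| ^+ (beta - 1) =
    \prod_(i < m) `|tnth x (lift ord0 i)| ^+ (beta - 1).
  by apply: eq_bigr => i _; rewrite tnth_behead_lift.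
ring.
Qed.

Lemma powsum_split p m (x : m.+1.-tuple R) :
  powsum p x = `|tnth x ord0| `^ p + powsum p [tuple of behead x].
Proof.
rewrite /powsum big_ord_recl; congr (_ + _).
by apply: eq_bigr => j _; rewrite tnth_behead_lift.
Qed.

Lemma tame_behead m (F : m.-tuple mR -> R) : tame F ->
  tame (fun x : m.+1.-tuple mR => F [tuple of behead x]).
Proof.
move=> [mF [C [N [C0 hF]]]]; split.
  by apply: (measurableT_comp mF); exact: measurable_behead.
exists C, N; split=> // x; apply: le_trans (hF _) _; rewrite ler_wpM2l//.
rewrite lerXn2r ?nnegrE ?qprod_ge0// /qprod [leRHS]big_ord_recl.
rewrite -[leLHS]mul1r ler_pM ?prodr_ge0//.
- by move=> i _; rewrite addr_ge0 ?sqr_ge0.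
- by rewrite lerDl sqr_ge0.
- by under eq_bigr do rewrite tnth_behead_lift.
Qed.

Lemma density_scale0 beta p m (x : m.+1.-tuple R) t : 1 <= p -> 0 <= t ->
  density beta p (scale0 t x) =
  expR (- (t `^ p * `|tnth x ord0| `^ p)) *
  (\prod_(j < m) `|t ^+ 2 * tnth x ord0 ^+ 2 - tnth x (lift ord0 j) ^+ 2|) ^+ beta *
  t ^+ (beta - 1) *
  (`|tnth x ord0| ^+ (beta - 1) * expR (- powsum p [tuple of behead x]) *
   vandermonde beta [tuple of behead x]).
Proof.
move=> p1 t0; rewrite densityE// vandermonde_split powsum_split behead_scale0.
rewrite tnth_scale0_0 normrM (ger0_norm t0) powRM// opprD expRD exprMn.
under eq_bigr do rewrite tnth_scale0_lift exprMn.
ring.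
Qed.

Lemma mul_expRN_le (u : R) : 0 <= u -> (1 + u) * expR (- u) <= 3 * expR (- (2^-1 * u)).
Proof.
move=> u0.
have -> : expR (- u) = expR (- (2^-1 * u)) * expR (- (2^-1 * u)).
  by rewrite -expRD; congr expR; field.
rewrite mulrA ler_wpM2r ?expR_ge0// expRN ler_pdivrMr ?expR_gt0//.
by have := expR_ge1Dx (2^-1 * u); lra.
Qed.

Lemma integrable_tame_density beta p n (F : n.-tuple mR -> R) : 1 <= p -> tame F ->
  (lebn n).-integrable setT (fun x => (F x * density beta p (x : n.-tuple R))%:E).
Proof.
move=> p1 tF.
apply: (integrable_tame_exp p1 (G := fun x => F x * vandermonde beta (x : n.-tuple R))).
- by apply: measurable_funM; [case: tF|exact: measurable_density].
- by apply: tameM => //; exact: tame_vandermonde.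
move=> x; rewrite densityE// !normrM mulrA [expR _]lock mulrAC -lock ler_wpM2l
  ?mulr_ge0//.
rewrite ger0_norm ?expR_ge0// ler_expR.
by have := powsum_ge0 p (x : n.-tuple R); lra.
Qed.

Lemma integrable_tame_powR_density beta p n (F : n.-tuple mR -> R) i : 1 <= p -> tame F ->
  (lebn n).-integrable setT
    (fun x => (`|tnth x i| `^ p * F x * density beta p (x : n.-tuple R))%:E).
Proof.
move=> p1 tF.
apply: (integrable_tame_exp p1 (G := fun x => 3 * (F x * vandermonde beta (x :
  n.-tuple R)))).
- apply: measurable_funM; last exact: measurable_density.
  apply: measurable_funM; last by case: tF.
  apply: (measurableT_comp (measurable_powR p)).
  by apply: measurableT_comp; [exact: normr_measurable|exact: measurable_tnthR].
- by apply: tameM; [exact: tame_cst|apply: tameM => //; exact: tame_vandermonde].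
move=> x; rewrite densityE//.
set u := `|tnth x i| `^ p; have u0 : 0 <= u by exact: powR_ge0.
have uS : u <= powsum p (x : n.-tuple R).
  by rewrite /powsum (bigD1 i)//= lerDl sumr_ge0// => j _; exact: powR_ge0.
set S := powsum _ _ in uS *; have S0 : 0 <= S by exact: le_trans uS.
have h : u * expR (- S) <= 3 * expR (- (2^-1 * S)).
  apply: le_trans (mul_expRN_le S0); rewrite ler_wpM2r ?expR_ge0//; lra.
rewrite (_ : u * F x * _ = F x * vandermonde beta (x : n.-tuple R) * (u * expR (-
  S))); last by ring.
rewrite normrM (ger0_norm (_ : 0 <= u * _)) ?mulr_ge0 ?expR_ge0//.
rewrite [X in _ <= X * _]normrM (ger0_norm (ler0n _ 3)) [3 * _]mulrC -mulrA.
by rewrite ler_wpM2l.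
Qed.

(** Times the density, this is, off the diagonals, the derivative at t = 1 of t times G and the
    density at [scale0 t x]. The coefficient beta comes from the Jacobian t together with |t
    x_1|^(beta - 1); [DG] stands for x_1 d_1 G. *)
Definition ibp_term beta p m (G DG : m.+1.-tuple mR -> R) (x : m.+1.-tuple mR) : R :=
  beta%:R * G x + DG x +
  2 * beta%:R * (\sum_(j < m) tnth x ord0 ^+ 2 * G x /
     (tnth x ord0 ^+ 2 - tnth x (lift ord0 j) ^+ 2)) -
  p * (`|tnth x ord0| `^ p * G x).

(** Along a dilation the weighted function is a product of factors, each with a size bound and a
    relative Lipschitz constant on [1, 2], which yields the dominating function. Where the squares
    are distinct, the factors also have explicit derivatives, which yields the limit. *)
Lemma dilation_ibp beta p m (G DG B : m.+1.-tuple mR -> R) K :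
  (0 < beta)%N -> 1 <= p ->
  (forall x, 0 <= G x) -> tame G -> measurable_fun [set: m.+1.-tuple mR] DG ->
  tame B -> (forall x, rlip12 (fun t => G (scale0 t x)) (B x) K) ->
  (forall x, is_derive (1 : R) (1 : R) (fun t => G (scale0 t x)) (DG x)) ->
  (lebn m.+1).-integrable setT
     (fun x => (ibp_term beta p G DG x * density beta p (x : m.+1.-tuple R))%:E) /\
  (\int[lebn m.+1]_x (ibp_term beta p G DG x * density beta p (x : m.+1.-tuple R))%:E
    = 0)%E.
Proof.
move=> beta0 p1 G0 tG mDG tB lipG derG.
have p0 : 0 <= p by exact: le_trans p1.
have [Ke hKe] := rlip12_expR_powR p0.
pose y0 (x : m.+1.-tuple mR) : R := tnth x ord0 ^+ 2.
pose y (j : 'I_m) (x : m.+1.-tuple mR) : R := tnth x (lift ord0 j) ^+ 2.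
pose u (x : m.+1.-tuple mR) : R := `|tnth x ord0| `^ p.
pose A (x : m.+1.-tuple mR) : R := `|tnth x ord0| ^+ (beta - 1) *
   vandermonde beta ([tuple of behead x] : m.-tuple R).
pose rest (x : m.+1.-tuple mR) : R := `|tnth x ord0| ^+ (beta - 1) *
   expR (- powsum p ([tuple of behead x] : m.-tuple R)) *
   vandermonde beta ([tuple of behead x] : m.-tuple R).
have rest0 x : 0 <= rest x.
  apply: mulr_ge0; last exact: vandermonde_ge0.
  by rewrite mulr_ge0 ?expR_ge0// exprn_ge0.
pose Pi (x : m.+1.-tuple mR) t := \prod_(j < m) `|t ^+ 2 * y0 x - y j x|.
(* The Jacobian t and t^(beta - 1) merge into t^beta; everything independent of t goes into
   [rest]. *)
have fE x t : 0 <= t -> t * (G (scale0 t x) * density beta p (scale0 t x)) =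
    G (scale0 t x) * (t ^+ beta * (expR (- (t `^ p * u x)) * Pi x t ^+ beta)) * rest x.
  move=> t0; rewrite density_scale0// -/(u x) -/(rest x) -/(Pi x t).
  have -> : t ^+ beta = t * t ^+ (beta - 1) by rewrite -exprS subn1 prednK.
  ring.
(* The product of the size bounds and, in [Kt], the sum of the relative Lipschitz constants of the
   factors in [fE]. *)
pose c x := B x * (2 ^+ beta * (((1 + u x) * expR (- u x)) *
   (\prod_(j < m) (4 * y0 x + y j x)) ^+ beta)).
pose Kt := K + (beta%:R * 1 + (Ke + beta%:R * ((size (index_enum 'I_m))%:R * 1))).
have lipf x : rlip12 (fun t => G (scale0 t x) *
     (t ^+ beta * (expR (- (t `^ p * u x)) * Pi x t ^+ beta))) (c x) Kt.
  apply: rlip12M => //; apply: rlip12M; first exact: (rlip12X beta rlip12_id).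
  apply: rlip12M; first by apply: hKe; exact: powR_ge0.
  apply: rlip12X; apply: rlip12_prod => j; apply: rlip12_norm.
  by apply: rlip12_quad; exact: sqr_ge0.
pose g x := Kt * c x * rest x.
have Kt0 : 0 <= Kt by case: (lipf [tuple of nseq m.+1 0]).
have mP : measurable_fun [set: m.+1.-tuple mR]
    (fun x : m.+1.-tuple mR => density beta p (x : m.+1.-tuple R)).
  exact: measurable_density.
have my j : measurable_fun [set: m.+1.-tuple mR] (y j).
  by apply: measurable_funX; exact: measurable_tnthR.
have my0 : measurable_fun [set: m.+1.-tuple mR] y0.
  by apply: measurable_funX; exact: measurable_tnthR.
have mu : measurable_fun [set: m.+1.-tuple mR] u.
  apply: (measurableT_comp (measurable_powR p)).
  by apply: measurableT_comp; [exact: normr_measurable|exact: measurable_tnthR].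
have [mG _] := tG.
have tA : tame A.
  apply: tameM; first by apply: tameX; apply: tame_norm; exact: tame_coord.
  apply: (tame_behead (F := fun x => vandermonde beta (x : m.-tuple R))).
  exact: tame_vandermonde.
have tP : tame (fun x => (\prod_(j < m) (4 * y0 x + y j x)) ^+ beta).
  apply: tameX; apply: tame_prod => j _; apply: tameD.
    by apply: tameM; [exact: tame_cst|apply: tameX; exact: tame_coord].
  by apply: tameX; exact: tame_coord.
pose H x := Kt * (B x * (2 ^+ beta * ((\prod_(j < m) (4 * y0 x + y j x)) ^+ beta * A x))).
have tH : tame H.
  apply: tameM; first exact: tame_cst.
  apply: tameM => //; apply: tameM; first exact: tame_cst.
  exact: tameM.
have gE x : g x = H x * ((1 + u x) * expR (- u x) *
    expR (- powsum p ([tuple of behead x] : m.-tuple R))).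
  by rewrite /g /H /c /rest /A; ring.
apply: (dilation_derivative (f := fun x => G x * density beta p (x : m.+1.-tuple R))
  (g := g)).
- exact: measurable_funM.
- by move=> x; rewrite mulr_ge0 ?density_ge0.
- exact: integrable_tame_density.
- apply: measurable_funM => //; apply: measurable_funB.
    apply: measurable_funD.
      by apply: measurable_funD => //; exact: measurable_funM.
    apply: measurable_funM => //; apply: measurable_sum => j.
    apply: measurable_funM; first exact: measurable_funM.
    by apply: measurable_invR; apply: measurable_funB; [exact: my0|exact: my].
  by apply: measurable_funM => //; exact: measurable_funM.
(* The bound (1 + u) exp(-u) <= 3 exp(-u/2) spends half the exponent of the first coordinate on the
   factor 1 + u; what is left still dominates exp(-powsum/2) times a polynomial, in the sense needed
   here. *)
- apply: (integrable_tame_exp p1 (G := fun x => 3 * H x)).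
  + rewrite (_ : g = fun x => H x * ((1 + u x) * expR (- u x) *
      expR (- powsum p ([tuple of behead x] : m.-tuple R)))); last exact/funext.
    have [mH _] := tH; apply: measurable_funM => //.
    apply: measurable_funM; first apply: measurable_funM.
    * exact: measurable_funD.
    * by apply: measurableT_comp => //; exact: measurableT_comp.
    * apply: measurableT_comp => //; apply: measurableT_comp => //.
      rewrite (_ : (fun x => _) = fun x => powsum p (x : m.+1.-tuple R) - u x).
        by apply: measurable_funB => //; exact: measurable_powsum.
      by apply/funext => x; rewrite powsum_split addrC addKr.
  + by apply: tameM => //; exact: tame_cst.
  move=> x; rewrite gE powsum_split -/(u x) [`|3 * _|]normrM (ger0_norm (ler0n _ 3)).
  rewrite normrM [3 * _]mulrC -[leRHS]mulrA ler_wpM2l//.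
  have u0 : 0 <= u x by exact: powR_ge0.
  rewrite ger0_norm; last by rewrite !mulr_ge0 ?expR_ge0 ?addr_ge0.
  rewrite mulrDr opprD expRD mulrA; apply: ler_pM; rewrite ?expR_ge0//.
  + by rewrite mulr_ge0 ?expR_ge0 ?addr_ge0.
  + exact: mul_expRN_le.
  + by rewrite ler_expR; have := powsum_ge0 p ([tuple of behead x] : m.-tuple R); lra.
- move=> x t t1 t2; have [_ _ /(_ t t1 t2)[_ h]] := lipf x.
  have t0 : 0 <= t by exact: le_trans t1.
  rewrite fE//; have := fE x 1 ler01; rewrite mul1r scale01 => ->.
  rewrite -mulrBl normrM (ger0_norm (rest0 x)).
  rewrite (_ : (t - 1) * g x = Kt * c x * (t - 1) * rest x); last by rewrite /g; ring.
  by rewrite ler_wpM2r//; move: h; rewrite scale01.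
- have [N [mN N0 sub]] := @null_coincide_sqr R m.
  exists N; split=> // x nx; apply: sub => /= hx; apply: nx.
  have yy j : y0 x != y j x by exact: hx.
  have d1 : is_derive (1 : R) (1 : R) (fun t => t ^+ beta) (1 ^+ beta * (beta%:R * 1)).
    apply: (is_derive1_logX (phi := id)); rewrite mulr1; exact: is_derive_id.
  have d2 := is_derive1_expR_powR p (u x).
  have d3 : is_derive (1 : R) (1 : R) (fun t => Pi x t ^+ beta)
      (Pi x 1 ^+ beta * (beta%:R * \sum_(j < m) 2 * y0 x / (y0 x - y j x))).
    apply: is_derive1_logX.
    have d j := is_derive1_norm_quad (yy j).
    exact: (is_derive1_log_prod (index_enum 'I_m) d).
  have d4 := is_derive1M (is_derive1M (derG x) (is_derive1M d1 (is_derive1M d2 d3)))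
     (is_derive_cst (rest x) (1 : R) (1 : R)).
  (* [fE] asks for t >= 0, which holds near 1 and is enough for a derivative at 1. *)
  apply: (near_eq_is_derive (f := fun t => G (scale0 t x) *
     (t ^+ beta * (expR (- (t `^ p * u x)) * Pi x t ^+ beta)) * rest x)).
    near=> t; rewrite fE//; apply: ltW.
    by near: t; exact: (lt_nbhsr (@ltr01 R)).
  apply: (is_derive_eq d4).
  rewrite /cst scale01 powR1 mul1r expr1n.
  have -> : density beta p x = expR (- u x) * Pi x 1 ^+ beta * rest x.
    have := @density_scale0 beta p m x 1 p1 ler01.
    by rewrite scale01 => ->; rewrite -/(Pi x 1) -/(rest x) powR1 mul1r expr1n mulr1.
  rewrite /ibp_term -/(y0 x) -/(u x).
  rewrite (_ : \sum_(j < m) y0 x * G x / _ = G x * (2^-1 * \sum_(j < m) 2 * y0 x /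
    (y0 x - y j x))).
    by field.
  rewrite !mulr_sumr; apply: eq_bigr => j _; rewrite -/(y j x).
  by have := yy j; rewrite -subr_eq0 => h; field.
Unshelve. all: by end_near. Qed.

End ibp.
(** * Loop equations *)

Section moments.
Context {R : realType}.
Local Notation mR := (measurableTypeR R).
Local Notation lebn := (@lebesgue_tuple R).

Definition wint beta p n (F : n.-tuple R -> R) :=
  (lebn n).-integrable setT
    (fun x : n.-tuple mR => (F x * density beta p (x : n.-tuple R))%:E).

Lemma MintE beta p n (F : n.-tuple R -> R) :
  Mint beta p F = fine (\int[lebn n]_x (F x * density beta p x)%:E)%E.
Proof. by []. Qed.

Lemma wintD beta p n (F G : n.-tuple R -> R) : wint beta p F -> wint beta p G ->
  wint beta p (fun x => F x + G x).
Proof.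
move=> hF hG; have := integrableD measurableT hF hG.
by congr (integrable _ _ _); apply/funext => x; rewrite mulrDl EFinD.
Qed.

Lemma wintZ beta p n (F : n.-tuple R -> R) (c : R) : wint beta p F ->
  wint beta p (fun x => c * F x).
Proof.
move=> hF; have := integrableZl measurableT c hF.
by congr (integrable _ _ _); apply/funext => x; rewrite -mulrA EFinM.
Qed.

Lemma wintB beta p n (F G : n.-tuple R -> R) : wint beta p F -> wint beta p G ->
  wint beta p (fun x => F x - G x).
Proof.
move=> hF hG; have := integrableB measurableT hF hG.
by congr (integrable _ _ _); apply/funext => x; rewrite mulrBl EFinB.
Qed.

Lemma MintD beta p n (F G : n.-tuple R -> R) : wint beta p F -> wint beta p G ->
  Mint beta p (fun x => F x + G x) = Mint beta p F + Mint beta p G.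
Proof.
move=> hF hG; rewrite /Mint -(RintegralD measurableT hF hG).
by apply: eq_Rintegral => x _; rewrite mulrDl.
Qed.

Lemma MintB beta p n (F G : n.-tuple R -> R) : wint beta p F -> wint beta p G ->
  Mint beta p (fun x => F x - G x) = Mint beta p F - Mint beta p G.
Proof.
move=> hF hG; rewrite /Mint -(RintegralB measurableT hF hG).
by apply: eq_Rintegral => x _; rewrite mulrBl.
Qed.

Lemma MintZ beta p n (F : n.-tuple R -> R) (c : R) : wint beta p F ->
  Mint beta p (fun x => c * F x) = c * Mint beta p F.
Proof.
move=> hF; rewrite /Mint -(RintegralZl c measurableT hF).
by apply: eq_Rintegral => x _; rewrite mulrA.
Qed.

Lemma eq_Mint_density beta p n (F G : n.-tuple R -> R) :
  (forall x, F x * density beta p x = G x * density beta p x) ->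
  Mint beta p F = Mint beta p G.
Proof. by move=> FG; apply: eq_Rintegral => x _; exact: FG. Qed.

Lemma Mint_ge0 beta p n (F : n.-tuple R -> R) : (forall x, 0 <= F x) ->
  0 <= Mint beta p F.
Proof.
by move=> F0; apply: Rintegral_ge0 => x _; rewrite mulr_ge0 ?density_ge0.
Qed.

Lemma wint0 beta p n : wint beta p (fun _ : n.-tuple R => 0).
Proof.
have := @integrable0 _ (n.-tuple mR) R (lebn n) setT.
by congr (integrable _ _ _); apply/funext => x; rewrite mul0r.
Qed.

Lemma Mint0 beta p n : Mint beta p (fun _ : n.-tuple R => 0) = 0.
Proof.
rewrite MintE; under eq_integral do rewrite mul0r.
by rewrite integral0.
Qed.

Lemma wint_sum beta p n (I : Type) (r : seq I) (F : I -> n.-tuple R -> R) :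
  (forall i, wint beta p (F i)) -> wint beta p (fun x => \sum_(i <- r) F i x).
Proof.
move=> hF; elim: r => [|i r IH].
  rewrite (_ : (fun x => _) = fun=> 0); first exact: wint0.
  by apply/funext => x; rewrite big_nil.
rewrite (_ : (fun x => _) = fun x => F i x + \sum_(i <- r) F i x); first exact: wintD.
by apply/funext => x; rewrite big_cons.
Qed.

Lemma Mint_sum beta p n (I : Type) (r : seq I) (F : I -> n.-tuple R -> R) :
  (forall i, wint beta p (F i)) ->
  Mint beta p (fun x => \sum_(i <- r) F i x) = \sum_(i <- r) Mint beta p (F i).
Proof.
move=> hF; elim: r => [|i r IH].
  rewrite big_nil (_ : (fun x => _) = fun=> 0); first exact: Mint0.
  by apply/funext => x; rewrite big_nil.
rewrite big_cons -IH -MintD//; last exact: wint_sum.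
by congr Mint; apply/funext => x; rewrite big_cons.
Qed.

(** * Invariance of the weight under permutations *)

Lemma prod_lt_neq n (a : 'I_n -> 'I_n -> R) : (forall i j, a i j = a j i) ->
  (\prod_(i < n) \prod_(j < n | (i < j)%N) a i j) ^+ 2 =
  \prod_(i < n) \prod_(j < n | j != i) a i j.
Proof.
move=> asym; rewrite expr2.
have {2}-> : \prod_(i < n) \prod_(j < n | (i < j)%N) a i j =
    \prod_(i < n) \prod_(j < n | (j < i)%N) a i j.
  rewrite (exchange_big_dep xpredT)//=; apply: eq_bigr => i _.
  by apply: eq_bigr => j _.
rewrite -big_split/=; apply: eq_bigr => i _.
rewrite [RHS](bigID (fun j : 'I_n => (i < j)%N))/=; congr (_ * _).
  by apply: eq_bigl => j; rewrite andb_idl// => ij; rewrite gt_eqF.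
by apply: eq_bigl => j; rewrite -leqNgt ltn_neqAle.
Qed.

(** A permutation does not preserve the range i < j. The square of the product runs over all ordered
    pairs of distinct indices, a range that is preserved, and both sides are nonnegative. *)
Lemma vandermonde_perm beta n (s : 'S_n) (x : n.-tuple R) :
  vandermonde beta (perm_tuple s x) = vandermonde beta x.
Proof.
rewrite /vandermonde; congr (_ * _); last first.
  rewrite [RHS](reindex_inj (@perm_inj _ s))/=.
  by apply: eq_bigr => i _; rewrite tnth_perm_tuple.
set A := LHS; set B := RHS.
have A0 : 0 <= A by apply: prodr_ge0 => i _; apply: prodr_ge0 => j _; exact: exprn_ge0.
have B0 : 0 <= B by apply: prodr_ge0 => i _; apply: prodr_ge0 => j _; exact: exprn_ge0.
apply/eqP; rewrite -(@eqrXn2 _ 2)//; apply/eqP.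
rewrite !prod_lt_neq; try by move=> i j; rewrite distrC.
rewrite [RHS](reindex_inj (@perm_inj _ s))/=; apply: eq_bigr => i _.
rewrite [RHS](reindex_inj (@perm_inj _ s))/=; apply: eq_big => j.
  by rewrite (inj_eq perm_inj).
by rewrite !tnth_perm_tuple.
Qed.

Lemma density_perm beta p n (s : 'S_n) (x : n.-tuple R) : 1 <= p ->
  density beta p (perm_tuple s x) = density beta p x.
Proof.
move=> p1; rewrite !densityE// vandermonde_perm.
suff -> : powsum p (perm_tuple s x) = powsum p x by [].
rewrite /powsum [RHS](reindex_inj (@perm_inj _ s))/=.
by apply: eq_bigr => i _; rewrite tnth_perm_tuple.
Qed.

Lemma Mint_perm beta p n (s : 'S_n) (F : n.-tuple R -> R) : 1 <= p ->
  wint beta p F -> Mint beta p (fun x => F (perm_tuple s x)) = Mint beta p F.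
Proof.
move=> p1 hF; rewrite !MintE; congr fine.
rewrite -[RHS](integral_lebesgue_tuple_perm s); last exact: (measurable_int _ hF).
by apply: eq_integral => x _; rewrite density_perm.
Qed.

Lemma wint_perm beta p n (s : 'S_n) (F : n.-tuple R -> R) : 1 <= p ->
  wint beta p F -> wint beta p (fun x => F (perm_tuple s x)).
Proof.
move=> p1 hF; have mF := measurable_int _ hF; apply/integrableP; split.
  rewrite (_ : (fun x => _) = (fun x => (F x * density beta p (x : n.-tuple R))%:E) \o
      (fun x : n.-tuple mR => perm_tuple s x : n.-tuple mR)).
    by apply: (measurableT_comp mF); exact: measurable_perm_tuple.
  by apply/funext => x /=; rewrite density_perm.
have /integrableP[_] := hF.
rewrite -(integral_lebesgue_tuple_perm s); last exact: measurableT_comp.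
by under eq_integral do rewrite density_perm//.
Qed.

(** On the box x_i in [2 i + 1, 2 i + 2], of volume 1, the coordinates and their gaps are at least
    1, so every Vandermonde factor is at least 1; and |x_i| <= 2 n bounds the exponential below by
    [c]. *)
Lemma Mint1_gt0 beta p n : 1 <= p -> 0 < Mint beta p (fun _ : n.-tuple R => 1).
Proof.
move=> p1; pose A (i : 'I_n) : set mR := `[(2 * i%:R + 1 : R), 2 * i%:R + 2]%classic.
pose X := [set x : n.-tuple mR | forall i, A i (tnth x i)].
have mX : measurable X by apply: measurable_box => i; exact: measurable_itv.
have X1 : lebn n X = 1%E.
  rewrite lebesgue_tuple_box; last by move=> i; exact: measurable_itv.
  rewrite big1// => i _; rewrite lebesgue_measure_itv/= lte_fin ltrD2l ltr1n.
  by rewrite -EFinB; congr EFin; ring.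
pose c : R := expR (- (n%:R * (2 * n%:R) `^ p)).
have w_ge x : X x -> c <= density beta p (x : n.-tuple R).
  move=> Xx; have hx (i : 'I_n) : 2 * i%:R + 1 <= tnth x i <= 2 * i%:R + 2.
    by have := Xx i; rewrite /A /= in_itv.
  have x0 i : 0 <= tnth x i.
    by have /andP[+ _] := hx i; apply: le_trans; rewrite addr_ge0 ?mulr_ge0.
  rewrite densityE// -[c]mulr1; apply: ler_pM; rewrite ?expR_ge0//.
    rewrite ler_expR lerN2 /powsum.
    apply: (@le_trans _ _ (\sum_(i < n) (2 * n%:R) `^ p)).
      apply: ler_sum => i _; apply: ge0_ler_powR; rewrite ?nnegrE ?mulr_ge0//.
        exact: le_trans p1.
      rewrite ger0_norm//; have /andP[_] := hx i; move/le_trans; apply.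
      have : (i.+1%:R : R) <= n%:R by rewrite ler_nat.
      by rewrite -natr1; lra.
    by rewrite sumr_const card_ord -[leLHS]mulr_natl.
  rewrite -[1]mulr1; apply: ler_pM => //.
    elim/big_ind : _ => // [a b a1 b1|i _]; first by rewrite mulr_ege1.
    elim/big_ind : _ => // [a b a1 b1|j ij]; first by rewrite mulr_ege1.
    apply: exprn_ege1; rewrite distrC; apply: le_trans (ler_norm _).
    have : (i.+1%:R : R) <= j%:R by rewrite ler_nat.
    have /andP[_ h1] := hx i; have /andP[h2 _] := hx j; have := x0 i; have := x0 j.
    by rewrite -natr1; nra.
  elim/big_ind : _ => // [a b a1 b1|i _]; first by rewrite mulr_ege1.
  apply: exprn_ege1; rewrite ger0_norm//.
  by have /andP[+ _] := hx i; apply: le_trans; rewrite lerDr mulr_ge0.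
have h1 : wint beta p (fun _ : n.-tuple R => 1).
  by apply: integrable_tame_density => //; exact: tame_cst.
apply: (@lt_le_trans _ _ c); first exact: expR_gt0.
rewrite MintE -lee_fin fineK; last exact: integrable_fin_num.
apply: (@le_trans _ _ (\int[lebn n]_x (c * \1_X x)%:E)%E).
  under eq_integral do rewrite EFinM.
  rewrite ge0_integralZl//; last 2 first.
  - exact/measurable_EFinP/measurable_indic.
  - by rewrite lee_fin expR_ge0.
  by rewrite integral_indic// setIT [X in (_ * X)%E](X1 : _ = _) mule1.
apply: ge0_le_integral => //.
- by move=> x _; rewrite lee_fin mulr_ge0 ?expR_ge0.
- by apply/measurable_EFinP; apply: measurable_funM => //; exact: measurable_indic.
- exact: (measurable_int _ h1).
- move=> x _; rewrite lee_fin mul1r indicE; have [xX|xX] := boolP (x \in X).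
    by rewrite mulr1; apply: w_ge; rewrite inE in xX.
  by rewrite mulr0 density_ge0.
Qed.

Definition sumsq n (x : n.-tuple R) : R := \sum_(i < n) tnth x i ^+ 2.

Lemma tame_sumsq n : tame (fun x : n.-tuple mR => sumsq (x : n.-tuple R)).
Proof. by apply: tame_sum => i _; apply: tameX; exact: tame_coord. Qed.

Lemma sumsq_perm n (s : 'S_n) (x : n.-tuple R) : sumsq (perm_tuple s x) = sumsq x.
Proof.
rewrite /sumsq [RHS](reindex_inj (@perm_inj _ s))/=.
by apply: eq_bigr => i _; rewrite tnth_perm_tuple.
Qed.

Lemma wint_tame beta p n (F : n.-tuple mR -> R) : 1 <= p -> tame F ->
  wint beta p (F : n.-tuple R -> R).
Proof. exact: integrable_tame_density. Qed.

Lemma wint_tame_powR beta p n (F : n.-tuple mR -> R) i : 1 <= p -> tame F ->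
  wint beta p (fun x : n.-tuple R => `|tnth x i| `^ p * F x).
Proof. exact: integrable_tame_powR_density. Qed.

Lemma density_eq0 beta p n (x : n.-tuple R) i j : (0 < beta)%N -> i != j ->
  tnth x i ^+ 2 = tnth x j ^+ 2 -> density beta p x = 0.
Proof.
move=> beta0; wlog ij : i j / (i < j)%N => [h|] ne xij.
  have [ij|ij] := ltnP i j; first exact: (h i j).
  by apply: (h j i) => //; [rewrite ltn_neqAle eq_sym ne|rewrite eq_sym].
rewrite /density (bigD1 i)//= (bigD1 j)//= xij subrr normr0 expr0n.
by rewrite eqn0Ngt beta0/= !mul0r mulr0 mul0r.
Qed.

(* Dilating each coordinate in turn and summing, the singular terms
   y_i g(y_i) / (y_i - y_k) pair up into divided differences q(y_i, y_k). On the
   diagonals, where the quotient is 0 by convention, the density vanishes. *)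
Lemma loop_equation beta p m (g h : R -> R -> R) (q : R -> R -> R -> R)
    (B : m.+1.-tuple mR -> R) K :
  (0 < beta)%N -> 1 <= p ->
  (forall (x : m.+1.-tuple mR), 0 <= g (tnth x ord0 ^+ 2) (sumsq (x : m.+1.-tuple R))) ->
  (forall i, tame (fun x : m.+1.-tuple mR => g (tnth x i ^+ 2) (sumsq (x :
    m.+1.-tuple R)))) ->
  (forall i, tame (fun x : m.+1.-tuple mR => h (tnth x i ^+ 2) (sumsq (x :
    m.+1.-tuple R)))) ->
  tame B ->
  (forall x, rlip12 (fun t => g (tnth (scale0 t x) ord0 ^+ 2) (sumsq (scale0 t x)))
    (B x) K) ->
  (forall x, is_derive (1 : R) (1 : R)
    (fun t => g (tnth (scale0 t x) ord0 ^+ 2) (sumsq (scale0 t x)))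
    (h (tnth x ord0 ^+ 2) (sumsq (x : m.+1.-tuple R)))) ->
  (forall y z s, y * g y s - z * g z s = (y - z) * q y z s) ->
  wint beta p (fun x : m.+1.-tuple R => \sum_i \sum_(k | k != i)
       q (tnth x i ^+ 2) (tnth x k ^+ 2) (sumsq x)) ->
  p * Mint beta p (fun x : m.+1.-tuple R => \sum_i
       `|tnth x i| `^ p * g (tnth x i ^+ 2) (sumsq x)) =
  Mint beta p (fun x : m.+1.-tuple R =>
     \sum_i (beta%:R * g (tnth x i ^+ 2) (sumsq x) + h (tnth x i ^+ 2) (sumsq x)) +
     beta%:R * \sum_i \sum_(k | k != i)
       q (tnth x i ^+ 2) (tnth x k ^+ 2) (sumsq x)).
Proof.
move=> beta0 p1 g0 tg th tB lipg derg gq wq.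
pose G (x : m.+1.-tuple mR) := g (tnth x ord0 ^+ 2) (sumsq (x : m.+1.-tuple R)).
pose DG (x : m.+1.-tuple mR) := h (tnth x ord0 ^+ 2) (sumsq (x : m.+1.-tuple R)).
have mDG : measurable_fun [set: m.+1.-tuple mR] DG by case: (th ord0).
have [iL L0] := dilation_ibp (G := G) (DG := DG) beta0 p1 g0 (tg ord0) mDG tB lipg derg.
pose L (x : m.+1.-tuple R) := ibp_term beta p G DG x.
pose P (x : m.+1.-tuple R) := \sum_i `|tnth x i| `^ p * g (tnth x i ^+ 2) (sumsq x).
pose Q (x : m.+1.-tuple R) := \sum_i \sum_(k | k != i)
   q (tnth x i ^+ 2) (tnth x k ^+ 2) (sumsq x).
pose A (x : m.+1.-tuple R) :=
  \sum_i (beta%:R * g (tnth x i ^+ 2) (sumsq x) + h (tnth x i ^+ 2) (sumsq x)).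
have wL : wint beta p L by exact: iL.
have wP : wint beta p P.
  by apply: wint_sum => i; exact: (wint_tame_powR beta i p1 (tg i)).
have wA : wint beta p A.
  apply: wint_sum => i; apply: wintD.
    by apply: wintZ; exact: (wint_tame beta p1 (tg i)).
  exact: (wint_tame beta p1 (th i)).
(* Dilating coordinate i is dilating the first one after transposing the two; as the density is
   symmetric, each summand has integral 0. *)
pose LL (x : m.+1.-tuple R) := \sum_i L (perm_tuple (tperm ord0 i) x).
have wLs i : wint beta p (fun x => L (perm_tuple (tperm ord0 i) x)) by exact: wint_perm.
have LL0 : Mint beta p LL = 0.
  rewrite (Mint_sum _ wLs) big1// => i _; rewrite Mint_perm//.
  by rewrite MintE [X in fine X]L0.
have LE x : LL x * density beta p x = (A x + beta%:R * Q x - p * P x) * density beta p x.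
  have [/existsP[i /existsP[k /andP[ik /eqP yik]]]|nd] := boolP
      [exists i, exists k, (i != k) && (tnth x i ^+ 2 == tnth x k ^+ 2)].
    by rewrite (density_eq0 p beta0 ik yik) !mulr0.
  have {}nd i k : i != k -> tnth x i ^+ 2 - tnth x k ^+ 2 != 0.
    move=> ik; rewrite subr_eq0; apply: contra nd => yik.
    by apply/existsP; exists i; apply/existsP; exists k; rewrite ik.
  congr (_ * _).
  pose a i k := tnth x i ^+ 2 * g (tnth x i ^+ 2) (sumsq x) / (tnth x i ^+ 2 - tnth x
    k ^+ 2).
  have LiE i : L (perm_tuple (tperm ord0 i) x) =
      (beta%:R * g (tnth x i ^+ 2) (sumsq x) + h (tnth x i ^+ 2) (sumsq x)) +
      2 * beta%:R * (\sum_(k | k != i) a i k) -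
      p * (`|tnth x i| `^ p * g (tnth x i ^+ 2) (sumsq x)).
    rewrite /L /ibp_term /G /DG sumsq_perm !tnth_perm_tuple tpermL.
    congr (_ + 2 * beta%:R * _ - _).
    rewrite [RHS](reindex_inj (@perm_inj _ (tperm ord0 i)))/= [RHS]big_mkcond/=.
    rewrite [RHS]big_ord_recl tpermL eqxx/= add0r; apply: eq_bigr => j _.
    rewrite tnth_perm_tuple /a ifT// -(inj_eq (@perm_inj _ (tperm ord0 i))) tpermK tpermR.
    by rewrite eq_sym neq_lift.
  (* Exchanging the names of i and k pairs a_ik with a_ki, and the sum of the two is q. The double
     sum of [a] is thus half of [Q], which turns the coefficient 2 beta into beta. *)
  have Qa : Q x = 2 * \sum_i \sum_(k | k != i) a i k.
    rewrite mulr2n mulrDl mul1r.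
    have {2}-> : \sum_i \sum_(k | k != i) a i k = \sum_i \sum_(k | k != i) a k i.
      rewrite (exchange_big_dep xpredT)//=; apply: eq_bigr => i _.
      by apply: eq_bigl => k; rewrite eq_sym.
    rewrite -big_split/=; apply: eq_bigr => i _.
    rewrite -big_split/=; apply: eq_bigr => k ki.
    have d1 := nd _ _ ki; have d2 : tnth x i ^+ 2 - tnth x k ^+ 2 != 0.
      by apply: nd; rewrite eq_sym.
    apply: (mulfI d2); rewrite -gq /a; field.
    by rewrite d1 d2.
  rewrite /LL; under eq_bigr do rewrite LiE.
  rewrite big_split/= sumrN -mulr_sumr big_split/= -mulr_sumr Qa /A /P.
  ring.
have wAQ : wint beta p (fun x => A x + beta%:R * Q x) by apply: wintD => //; exact: wintZ.
have := MintB wAQ (wintZ p wP); rewrite -(eq_Mint_density LE) LL0 (MintZ _ wP).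
by move/eqP; rewrite eq_sym subr_eq0 => /eqP <-.
Qed.

End moments.
(** * Moment relations and size estimates *)

Section moment_relations.
Context {R : realType}.
Local Notation mR := (measurableTypeR R).

Lemma sumsq_split m (x : m.+1.-tuple R) :
  sumsq x = tnth x ord0 ^+ 2 + sumsq [tuple of behead x].
Proof.
rewrite /sumsq big_ord_recl; congr (_ + _).
by apply: eq_bigr => j _; rewrite tnth_behead_lift.
Qed.

Lemma sumsq_ge0 n (x : n.-tuple R) : 0 <= sumsq x.
Proof. by apply: sumr_ge0 => i _; exact: sqr_ge0. Qed.

Lemma sumsq_scale0 t m (x : m.+1.-tuple R) :
  sumsq (scale0 t x) = t ^+ 2 * tnth x ord0 ^+ 2 + sumsq [tuple of behead x].
Proof. by rewrite sumsq_split behead_scale0 tnth_scale0_0 exprMn. Qed.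

Lemma tame_sqr n (i : 'I_n) : tame (fun x : n.-tuple mR => (tnth x i : R) ^+ 2).
Proof. by apply: tameX; exact: tame_coord. Qed.

Lemma sum_ord_const n (c : R) : \sum_(i < n) c = n%:R * c.
Proof. by rewrite sumr_const card_ord [RHS]mulr_natl. Qed.

Lemma sum_neq n (f : 'I_n -> R) (i : 'I_n) :
  \sum_(k < n | k != i) f k = \sum_(k < n) f k - f i.
Proof. by rewrite [X in X - _](bigD1 i)//= addrAC subrr add0r. Qed.

(** For g = 1 every divided difference is 1, and with n = m + 1 coordinates beta n + beta n (n - 1)
    = beta n^2. *)
Lemma Mint_powsum beta p m : (0 < beta)%N -> 1 <= p ->
  p * Mint beta p (fun x : m.+1.-tuple R => powsum p x) =
  beta%:R * m.+1%:R ^+ 2 * Mint beta p (fun _ : m.+1.-tuple R => 1).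
Proof.
move=> beta0 p1.
have w1 : wint beta p (fun _ : m.+1.-tuple R => 1).
  by apply: (wint_tame beta p1); exact: tame_cst.
have w2 : wint beta p (fun x : m.+1.-tuple R =>
     \sum_(i < m.+1) \sum_(k < m.+1 | k != i) 1).
  apply: (wint_tame beta p1 (F := fun=> _)); exact: tame_cst.
have := @loop_equation R beta p m (fun _ _ => 1) (fun _ _ => 0) (fun _ _ _ => 1)
  (fun=> `|1|) 0 beta0 p1.
move=> /(_ (fun=> ler01) (fun=> tame_cst _ _) (fun=> tame_cst _ _) (tame_cst _ _)).
move=> /(_ (fun=> rlip12_cst 1) (fun=> is_derive_cst _ _ _)).
have h (y z s : R) : y * 1 - z * 1 = (y - z) * 1 by rewrite !mulr1.
move=> /(_ h w2) {h}.
rewrite (_ : (fun x : m.+1.-tuple R => \sum_i `|tnth x i| `^ p * 1) = fun x => powsum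
  p x); last first.
  by apply/funext => x; apply: eq_bigr => i _; rewrite mulr1.
move=> ->; rewrite -MintZ//; congr Mint; apply/funext => x.
under [X in _ + _ * X]eq_bigr do rewrite sum_neq sum_ord_const.
rewrite !sum_ord_const; ring.
Qed.

(** For g = y the divided difference is y + z: the single terms contribute (beta + 2) S and the
    pairs 2 beta (n - 1) S. *)
Lemma Mint_powsum_sqr beta p m : (0 < beta)%N -> 1 <= p ->
  p * Mint beta p (fun x : m.+1.-tuple R =>
        \sum_i `|tnth x i| `^ p * tnth x i ^+ 2) =
  (2 * beta%:R * m.+1%:R - beta%:R + 2) * Mint beta p (fun x : m.+1.-tuple R => sumsq x).
Proof.
move=> beta0 p1.
have wS : wint beta p (fun x : m.+1.-tuple R => sumsq x).
  by apply: (wint_tame beta p1); exact: tame_sumsq.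
have tq : tame (fun x : m.+1.-tuple mR => \sum_(i < m.+1) \sum_(k < m.+1 | k != i)
     ((tnth x i : R) ^+ 2 + (tnth x k : R) ^+ 2)).
  by apply: tame_sum => i _; apply: tame_sum => k _; apply: tameD; exact: tame_sqr.
have e (x : m.+1.-tuple R) t : tnth (scale0 t x) ord0 ^+ 2 = t ^+ 2 * tnth x ord0 ^+
  2 - 0.
  by rewrite tnth_scale0_0 exprMn subr0.
have := @loop_equation R beta p m (fun y _ => y) (fun y _ => 2 * y) (fun y z _ => y + z)
  (fun x => 4 * (tnth x ord0 ^+ 2) + 0) 1 beta0 p1.
move=> /(_ (fun=> sqr_ge0 _) (fun=> tame_sqr _)).
have h1 i : tame (fun x : m.+1.-tuple mR => 2 * (tnth x i : R) ^+ 2).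
  by apply: tameM; [exact: tame_cst|exact: tame_sqr].
have h2 : tame (fun x : m.+1.-tuple mR => 4 * ((tnth x ord0 : R) ^+ 2) + 0).
  by apply: tameD; [apply: tameM; [exact: tame_cst|exact: tame_sqr]|exact: tame_cst].
move=> /(_ h1 h2) {h1 h2}.
have h1 (x : m.+1.-tuple R) : rlip12 (fun t => tnth (scale0 t x) ord0 ^+ 2) (4 * tnth
  x ord0 ^+ 2 + 0) 1.
  rewrite (_ : (fun t => _) = fun t => t ^+ 2 * tnth x ord0 ^+ 2 - 0); last first.
    by apply/funext => t; exact: e.
  by apply: rlip12_quad => //; exact: sqr_ge0.
have h2 (x : m.+1.-tuple R) : is_derive (1 : R) (1 : R) (fun t => tnth (scale0 t x)
  ord0 ^+ 2) (2 * tnth x ord0 ^+ 2).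
  rewrite (_ : (fun t => _) = fun t => t ^+ 2 * tnth x ord0 ^+ 2 - 0); last first.
    by apply/funext => t; exact: e.
  exact: is_derive1_quad.
have h3 (y z s : R) : y * y - z * z = (y - z) * (y + z) by ring.
move=> /(_ h1 h2 h3 (wint_tame beta p1 tq)) {h1 h2 h3} ->.
rewrite -MintZ//; congr Mint; apply/funext => x.
have h i : \sum_(k < m.+1 | k != i) (tnth x i ^+ 2 + tnth x k ^+ 2) =
    (m.+1%:R - 2) * tnth x i ^+ 2 + sumsq x.
  rewrite sum_neq big_split/= sum_ord_const -/(sumsq x); ring.
rewrite (eq_bigr _ (fun i _ => h i)) !big_split/= -!mulr_sumr sum_ord_const -/(sumsq x).
ring.
Qed.

Definition sumquart n (x : n.-tuple R) : R := \sum_(i < n) (tnth x i ^+ 2) ^+ 2.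

Lemma tame_sumquart n : tame (fun x : n.-tuple mR => sumquart (x : n.-tuple R)).
Proof. by apply: tame_sum => i _; apply: tameX; exact: tame_sqr. Qed.

(* The loop equation for g = (y - l s)^2, whose left-hand side is nonnegative. *)
Lemma Mint_square_ge0 beta p m (l : R) : (0 < beta)%N -> 1 <= p -> 0 <= l -> l <= 1 ->
  0 <= (2 * beta%:R * (m.+1%:R - 1) + 4 * (1 - l)) *
         Mint beta p (fun x : m.+1.-tuple R => sumquart x) +
       (beta%:R + l ^+ 2 * (beta%:R * m.+1%:R ^+ 2 + 4) -
          l * (4 * beta%:R * m.+1%:R - 2 * beta%:R + 4)) *
         Mint beta p (fun x : m.+1.-tuple R => sumsq x ^+ 2).
Proof.
move=> beta0 p1 l0 l1.
have wT : wint beta p (fun x : m.+1.-tuple R => sumquart x).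
  by apply: (wint_tame beta p1); exact: tame_sumquart.
have wS : wint beta p (fun x : m.+1.-tuple R => sumsq x ^+ 2).
  by apply: (wint_tame beta p1); apply: tameX; exact: tame_sumsq.
pose g (y s : R) : R := (y - l * s) ^+ 2.
(* [h] is x_1 d_1 g, where s also varies because it contains x_1^2; [q] is the divided difference of
   y (y - l s)^2 in y at fixed s. *)
pose h (y s : R) : R := 4 * (1 - l) * y * (y - l * s).
pose q (y z s : R) : R := y ^+ 2 + y * z + z ^+ 2 - 2 * l * s * (y + z) + l ^+ 2 * s ^+ 2.
have tls : tame (fun x : m.+1.-tuple mR => l * sumsq (x : m.+1.-tuple R)).
  by apply: tameM; [exact: tame_cst|exact: tame_sumsq].
have tq : tame (fun x : m.+1.-tuple mR => \sum_(i < m.+1) \sum_(k < m.+1 | k != i)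
     q (tnth x i ^+ 2) (tnth x k ^+ 2) (sumsq (x : m.+1.-tuple R))).
  apply: tame_sum => i _; apply: tame_sum => k _.
  apply: tameD; last by apply: tameM; [exact: tame_cst|apply: tameX; exact: tame_sumsq].
  apply: tameB; last first.
    apply: tameM; last by apply: tameD; exact: tame_sqr.
    by apply: tameM; [exact: tame_cst|exact: tame_sumsq].
  apply: tameD; last by apply: tameX; exact: tame_sqr.
  by apply: tameD; [apply: tameX; exact: tame_sqr|apply: tameM; exact: tame_sqr].
(* Since s contains the dilated y, the difference y - l s is a - b with [a] collecting the dilated
   coordinate and [b] the others; l <= 1 makes [a] nonnegative. *)
pose a (x : m.+1.-tuple R) := (1 - l) * tnth x ord0 ^+ 2.
pose b (x : m.+1.-tuple R) := l * sumsq [tuple of behead x].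
have a0 x : 0 <= a x by rewrite mulr_ge0 ?subr_ge0 ?sqr_ge0.
have b0 x : 0 <= b x by rewrite mulr_ge0 ?sumsq_ge0.
have e (x : m.+1.-tuple R) t : tnth (scale0 t x) ord0 ^+ 2 - l * sumsq (scale0 t x) =
    t ^+ 2 * a x - b x.
  by rewrite tnth_scale0_0 sumsq_scale0 exprMn /a /b; ring.
have := @loop_equation R beta p m g h q (fun x => (4 * a x + b x) ^+ 2) (2%:R * 1)
  beta0 p1.
move=> /(_ (fun=> sqr_ge0 _)).
have h1 i : tame (fun x : m.+1.-tuple mR => g (tnth x i ^+ 2) (sumsq (x : m.+1.-tuple
  R))).
  by apply: tameX; apply: tameB => //; exact: tame_sqr.
have h2 i : tame (fun x : m.+1.-tuple mR => h (tnth x i ^+ 2) (sumsq (x : m.+1.-tuple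
  R))).
  apply: tameM; last by apply: tameB => //; exact: tame_sqr.
  by apply: tameM; [exact: tame_cst|exact: tame_sqr].
have h3 : tame (fun x : m.+1.-tuple mR => (4 * a (x : m.+1.-tuple R) + b (x :
  m.+1.-tuple R)) ^+ 2).
  apply: tameX; apply: tameD.
    apply: tameM; first exact: tame_cst.
    by apply: tameM; [exact: tame_cst|exact: tame_sqr].
  apply: tameM; first exact: tame_cst.
  apply: (tame_behead (F := fun x => sumsq (x : m.-tuple R))); exact: tame_sumsq.
move=> /(_ h1 h2 h3) {h1 h2 h3}.
have h1 (x : m.+1.-tuple R) : rlip12 (fun t => g (tnth (scale0 t x) ord0 ^+ 2) (sumsq
  (scale0 t x)))
    ((4 * a x + b x) ^+ 2) (2%:R * 1).
  rewrite (_ : (fun t => _) = fun t => (t ^+ 2 * a x - b x) ^+ 2); last first.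
    by apply/funext => t; rewrite /g e.
  by apply: rlip12X; exact: rlip12_quad.
have h2 (x : m.+1.-tuple R) : is_derive (1 : R) (1 : R)
    (fun t => g (tnth (scale0 t x) ord0 ^+ 2) (sumsq (scale0 t x)))
    (h (tnth x ord0 ^+ 2) (sumsq x)).
  rewrite (_ : (fun t => _) = fun t => (t ^+ 2 * a x - b x) * (t ^+ 2 * a x - b x));
    last first.
    by apply/funext => t; rewrite /g e expr2.
  apply: (is_derive_eq (is_derive1M (is_derive1_quad (a x) (b x)) (is_derive1_quad (a
    x) (b x)))).
  by rewrite /h sumsq_split /a /b; ring.
have h3 (y z s : R) : y * g y s - z * g z s = (y - z) * q y z s by rewrite /g /q; ring.
move=> /(_ h1 h2 h3 (wint_tame beta p1 tq)) {h1 h2 h3} eq.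
have : 0 <= p * Mint beta p (fun x : m.+1.-tuple R =>
    \sum_i `|tnth x i| `^ p * g (tnth x i ^+ 2) (sumsq x)).
  apply: mulr_ge0; first exact: le_trans p1.
  by apply: Mint_ge0 => x; apply: sumr_ge0 => i _; rewrite mulr_ge0 ?powR_ge0 ?sqr_ge0.
rewrite eq => /le_trans; apply; rewrite le_eqVlt; apply/orP; left; apply/eqP.
rewrite -(MintZ _ wT) -(MintZ _ wS) -MintD; try exact: wintZ.
congr Mint; apply/funext => x; set S := sumsq x.
have sumqi i : \sum_(k < m.+1 | k != i) q (tnth x i ^+ 2) (tnth x k ^+ 2) S =
    (m.+1%:R - 3) * (tnth x i ^+ 2) ^+ 2 + (S - 2 * l * S * (m.+1%:R - 2)) * tnth x i
      ^+ 2 +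
    (sumquart x - 2 * l * S ^+ 2 + (m.+1%:R - 1) * l ^+ 2 * S ^+ 2).
  rewrite sum_neq (eq_bigr (fun k => ((tnth x i ^+ 2) ^+ 2 - 2 * l * S * tnth x i ^+
    2 + l ^+ 2 * S ^+ 2) +
     (tnth x i ^+ 2 - 2 * l * S) * tnth x k ^+ 2 + (tnth x k ^+ 2) ^+ 2)); last first.
    by move=> k _; rewrite /q; ring.
  rewrite !big_split/= !sum_ord_const -mulr_sumr -/(sumsq x) -/S -/(sumquart x) /q; ring.
have sumgi i : beta%:R * g (tnth x i ^+ 2) S + h (tnth x i ^+ 2) S =
    (beta%:R + 4 * (1 - l)) * (tnth x i ^+ 2) ^+ 2 +
    (- 2 * beta%:R * l * S - 4 * (1 - l) * l * S) * tnth x i ^+ 2 +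
    beta%:R * l ^+ 2 * S ^+ 2.
  by rewrite /g /h; ring.
rewrite (eq_bigr _ (fun i _ => sumgi i)) (eq_bigr _ (fun i _ => sumqi i)).
rewrite !big_split/= !sum_ord_const -!mulr_sumr -/(sumsq x) -/S -/(sumquart x).
ring.
Qed.

(** At l = 2/n the coefficient of the second integral in [Mint_square_ge0] is -3 beta up to
    O(beta/n), against 2 beta n for the first, and beta cancels. The condition n >= 2 ensures l <=
    1. *)
Lemma sumsq_sqr_le_sumquart beta p n : (0 < beta)%N -> 1 <= p -> (2 <= n)%N ->
  (3 / 2 - 13 / n%:R) * Mint beta p (fun x : n.-tuple R => sumsq x ^+ 2) <=
  n%:R * Mint beta p (fun x : n.-tuple R => sumquart x).
Proof.
case: n => [//|m] beta0 p1 n2.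
set A := Mint _ _ _; set T := Mint _ _ _.
have A0 : 0 <= A by apply: Mint_ge0 => x; exact: sqr_ge0.
have T0 : 0 <= T by apply: Mint_ge0 => x; apply: sumr_ge0 => i _; exact: sqr_ge0.
have b1 : 1 <= beta%:R :> R by rewrite ler1n.
have N2 : 2 <= m.+1%:R :> R by rewrite ler_nat.
set b : R := beta%:R in b1 *; set N : R := m.+1%:R in N2 *.
have N0 : N != 0 by rewrite gt_eqF//; lra.
have Ni2 : 2 * N^-1 <= 1 by rewrite ler_pdivrMr ?mul1r//; lra.
have l0 : 0 <= 2 * N^-1 by rewrite mulr_ge0// invr_ge0; lra.
have := @Mint_square_ge0 beta p m (2 * N^-1) beta0 p1 l0 Ni2.
rewrite -/A -/T -/b -/N.
rewrite (_ : b + (2 * N^-1) ^+ 2 * (b * N ^+ 2 + 4) - 2 * N^-1 * (4 * b * N - 2 * b + 4) =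
   - (3 * b) + (4 * b - 8) * N^-1 + 16 * N^-1 ^+ 2); last by field.
have rN : N^-1 * N = 1 by rewrite mulVf.
move: rN Ni2 l0; move: {N0} (N^-1) => r rN r2 r0 h.
have rr : r ^+ 2 <= r by rewrite expr2; nra.
(* The allowance 20 b r covers (4 b - 8) r + 16 r^2, because r^2 <= r and b >= 1. *)
have h1 : (3 * b - 20 * b * r) * A <= (2 * b * N + 4 * b) * T.
  have i1 : (2 * b * (N - 1) + 4 * (1 - 2 * r)) * T <= (2 * b * N + 4 * b) * T.
    by rewrite ler_wpM2r//; nra.
  have i2 : (3 * b - 20 * b * r) * A <= (3 * b - (4 * b - 8) * r - 16 * r ^+ 2) * A.
    by rewrite ler_wpM2r//; nra.
  lra.
have h2 : (3 - 20 * r) * A <= (2 + 4 * r) * (N * T).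
  rewrite -(ler_pM2l (_ : 0 < b)); last by lra.
  rewrite (_ : b * ((3 - 20 * r) * A) = (3 * b - 20 * b * r) * A); last by ring.
  rewrite (_ : b * ((2 + 4 * r) * (N * T)) = (2 * b * N + 4 * b * (r * N)) * T); last
    by ring.
  by rewrite rN mulr1.
(* The constant 13 makes the linear term of (2 + 4 r)(3/2 - 13 r) equal to -20 r, and the remaining
   -52 r^2 has the favourable sign. *)
rewrite -(ler_pM2l (_ : 0 < 2 + 4 * r)); last by lra.
apply: le_trans h2; rewrite mulrA ler_wpM2r//.
rewrite (_ : (2 + 4 * r) * (3 / 2 - 13 * r) = 3 - 20 * r - 52 * r ^+ 2); last by field.
have := sqr_ge0 r; lra.
Qed.

(** * Order of the second moment, uniformly in p *)

Lemma powR_half_sqr (p z : R) : (z ^+ 2) `^ (p / 2) = `|z| `^ p.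
Proof.
rewrite -real_normK ?num_real// -powR_mulrn// -powRrM; congr (_ `^ _).
by field.
Qed.

(** A threshold c n^(2/p) for z^2 is a threshold c^(p/2) n for |z|^p. *)
Lemma powR_scale_half (p c s : R) : 1 <= p -> 0 <= c -> 0 <= s ->
  (c * s `^ (2 / p)) `^ (p / 2) = c `^ (p / 2) * s.
Proof.
move=> p1 c0 s0; rewrite powRM ?powR_ge0// -powRrM.
rewrite (_ : 2 / p * (p / 2) = 1) ?powRr1//.
by field; rewrite gt_eqF// (lt_le_trans ltr01).
Qed.

(** Above the threshold 400 n^(2/p) one has |z|^p >= 20^p n >= 20 n, so z^2 <= |z|^p z^2 / (20 n).
    By [Mint_powsum_sqr], p >= 1 and beta <= 4, these terms add up to at most half of the left-hand
    side, which absorbs them. *)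
Lemma Mint_sumsq_le beta p n : (0 < beta)%N -> (beta <= 4)%N -> 1 <= p -> (0 < n)%N ->
  Mint beta p (fun x : n.-tuple R => sumsq x) <=
  800 * n%:R `^ (2 / p) * n%:R * Mint beta p (fun _ : n.-tuple R => 1).
Proof.
case: n => [//|m] beta0 beta4 p1 _.
set n : R := m.+1%:R; set a := n `^ (2 / p).
set Z := Mint _ _ (fun=> 1); set S := Mint _ _ _.
have n1 : 1 <= n by rewrite ler1n.
have n0 : 0 < n by lra.
have a0 : 0 < a by rewrite powR_gt0.
have S0 : 0 <= S by apply: Mint_ge0 => x; exact: sumsq_ge0.
have w1 : wint beta p (fun _ : m.+1.-tuple R => 1).
  by apply: (wint_tame beta p1); exact: tame_cst.
have wS : wint beta p (fun x : m.+1.-tuple R => sumsq x).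
  by apply: (wint_tame beta p1); exact: tame_sumsq.
have wP : wint beta p (fun x : m.+1.-tuple R => \sum_i `|tnth x i| `^ p * tnth x i ^+ 2).
  apply: wint_sum => i; apply: (wint_tame_powR beta i p1).
  exact: tame_sqr.
have c0 : 0 <= (20 * n)^-1 by rewrite invr_ge0; lra.
have pt (z : R) : z ^+ 2 <= 400 * a + (20 * n)^-1 * (`|z| `^ p * z ^+ 2).
  have [h|h] := leP (z ^+ 2) (400 * a).
    by rewrite (le_trans h)// lerDl mulr_ge0// mulr_ge0 ?sqr_ge0 ?powR_ge0.
  have : 20 * n <= `|z| `^ p.
    rewrite -powR_half_sqr; apply: (@le_trans _ _ ((400 * a) `^ (p / 2))).
      rewrite (powR_scale_half p1 (ler0n _ 400) (ltW n0)).
      apply: ler_wpM2r; first exact: ltW.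
      rewrite (_ : 400 = 20 ^+ 2); last by ring.
      by rewrite powR_half_sqr ger0_norm// le1r_powR// ler1n.
    by apply: ge0_ler_powR; rewrite ?nnegrE; [lra|lra|exact: sqr_ge0|exact: ltW].
  move=> h1; apply: (@le_trans _ _ ((20 * n)^-1 * (`|z| `^ p * z ^+ 2))); last by
    rewrite lerDr; nra.
  by rewrite mulrCA mulrA ler_peMl ?sqr_ge0// ler_pdivlMr ?mul1r//; lra.
have : S <= 400 * a * n * Z + (20 * n)^-1 * Mint beta p (fun x : m.+1.-tuple R =>
  \sum_i `|tnth x i| `^ p * tnth x i ^+ 2).
  rewrite -(MintZ _ w1) -(MintZ _ wP) -MintD; try exact: wintZ.
  rewrite -subr_ge0 -MintB//; last by apply: wintD; exact: wintZ.
  apply: Mint_ge0 => x; rewrite subr_ge0 mulr1 mulr_sumr.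
  rewrite (_ : 400 * a * n = \sum_(i < m.+1) 400 * a); last by rewrite sum_ord_const
    mulrC.
  rewrite -big_split/=.
  by apply: ler_sum => i _; exact: pt.
have X0 : 0 <= Mint beta p (fun x : m.+1.-tuple R => \sum_i `|tnth x i| `^ p * tnth x
  i ^+ 2).
  apply: Mint_ge0 => x; apply: sumr_ge0 => i _.
  by rewrite mulr_ge0 ?powR_ge0 ?sqr_ge0.
have := @Mint_powsum_sqr beta p m beta0 p1.
rewrite -/S -/n; move: X0; set X := Mint _ _ (fun x => \sum_i _) => X0 pX le1.
have b4 : beta%:R <= 4 :> R by rewrite (ler_nat _ _ 4).
have b0 : 0 <= beta%:R :> R by [].
have le2 : X <= (10 * n) * S.
  apply: (@le_trans _ _ (p * X)); first by rewrite ler_peMl.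
  by rewrite pX ler_wpM2r//; nra.
have le3 : (20 * n)^-1 * X <= 2^-1 * S.
  rewrite (_ : 2^-1 * S = (20 * n)^-1 * (10 * n * S)); first by rewrite ler_wpM2l.
  by field; rewrite gt_eqF.
have le4 : S <= 400 * a * n * Z + 2^-1 * S by apply: le_trans le1 _; rewrite lerD2l.
rewrite (_ : 800 * a * n * Z = 2 * (400 * a * n * Z)); last by ring.
move: le4; move: (400 * a * n * Z) => V; lra.
Qed.

(** Below the threshold exp(-4) n^(2/p) one has |z|^p <= exp(-2 p) n <= n / (2 p), so such
    coordinates account for at most half of the value given by [Mint_powsum]. The rest comes from
    coordinates with |z|^p <= |z|^p z^2 / threshold, and [Mint_powsum_sqr] converts this into a
    lower bound for the sum of squares. *)
Lemma Mint_sumsq_ge beta p n : (0 < beta)%N -> 1 <= p -> (0 < n)%N ->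
  expR (- 4) / 8 * n%:R `^ (2 / p) * n%:R * Mint beta p (fun _ : n.-tuple R => 1) <=
  Mint beta p (fun x : n.-tuple R => sumsq x).
Proof.
case: n => [//|m] beta0 p1 _.
set n : R := m.+1%:R; set a := n `^ (2 / p); set t := expR (- 4).
set Z := Mint _ _ (fun=> 1); set S := Mint _ _ _.
have n1 : 1 <= n by rewrite ler1n.
have n0 : 0 < n by lra.
have p0 : 0 < p by lra.
have a0 : 0 < a by rewrite powR_gt0.
have t0 : 0 < t by exact: expR_gt0.
have S0 : 0 <= S by apply: Mint_ge0 => x; exact: sumsq_ge0.
have Z0 : 0 <= Z by apply: Mint_ge0.
have w1 : wint beta p (fun _ : m.+1.-tuple R => 1).
  by apply: (wint_tame beta p1); exact: tame_cst.
have wX : wint beta p (fun x : m.+1.-tuple R => \sum_i `|tnth x i| `^ p * tnth x i ^+ 2).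
  apply: wint_sum => i; apply: (wint_tame_powR beta i p1).
  exact: tame_sqr.
have wP : wint beta p (fun x : m.+1.-tuple R => powsum p x).
  apply: wint_sum => i.
  rewrite (_ : (fun x => _) = fun x : m.+1.-tuple R => `|tnth x i| `^ p * 1).
    by apply: (wint_tame_powR beta i p1 (F := fun=> 1)); exact: tame_cst.
  by apply/funext => x; rewrite mulr1.
have ta0 : 0 < t * a by rewrite mulr_gt0.
have tp : t `^ (p / 2) <= (2 * p)^-1.
  rewrite /t -expRM (_ : - 4 * (p / 2) = - (2 * p)); last by field.
  rewrite expRN lef_pV2 ?posrE ?expR_gt0//; last by lra.
  by have := expR_ge1Dx (2 * p); lra.
have pt (z : R) : `|z| `^ p <= (2 * p)^-1 * n + (t * a)^-1 * (`|z| `^ p * z ^+ 2).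
  have zp0 := powR_ge0 `|z| p.
  have [h|h] := leP (z ^+ 2) (t * a).
    apply: (@le_trans _ _ ((2 * p)^-1 * n)); last first.
      by rewrite lerDl; apply: mulr_ge0; [rewrite invr_ge0 ltW|rewrite mulr_ge0//
        sqr_ge0].
    rewrite -powR_half_sqr; apply: (@le_trans _ _ ((t * a) `^ (p / 2))).
      by apply: ge0_ler_powR; rewrite ?nnegrE; [lra|exact: sqr_ge0|exact: ltW|].
    rewrite (powR_scale_half p1 (ltW t0) (ltW n0)).
    by apply: ler_wpM2r => //; exact: ltW.
  apply: (@le_trans _ _ ((t * a)^-1 * (`|z| `^ p * z ^+ 2))); last first.
    by rewrite lerDr mulr_ge0 ?invr_ge0 ?ltW//; lra.
  by rewrite mulrCA ler_peMr// mulrC ler_pdivlMr ?mul1r// ltW.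
have : Mint beta p (fun x : m.+1.-tuple R => powsum p x) <= (2 * p)^-1 * n * n * Z +
    (t * a)^-1 * Mint beta p (fun x : m.+1.-tuple R => \sum_i `|tnth x i| `^ p * tnth
      x i ^+ 2).
  rewrite -(MintZ _ w1) -(MintZ _ wX) -MintD; try exact: wintZ.
  rewrite -subr_ge0 -MintB//; last by apply: wintD; exact: wintZ.
  apply: Mint_ge0 => x; rewrite subr_ge0 mulr1 mulr_sumr.
  rewrite (_ : (2 * p)^-1 * n * n = \sum_(i < m.+1) (2 * p)^-1 * n); last by rewrite
    sum_ord_const mulrC.
  rewrite -big_split/=.
  by apply: ler_sum => i _; exact: pt.
have := @Mint_powsum_sqr beta p m beta0 p1; have := @Mint_powsum beta p m beta0 p1.
rewrite -/S -/n -/Z; set P := Mint _ _ (fun x => powsum p x); set X := Mint _ _ (fun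
  x => \sum_i _) => pP pX le1.
have b1 : 1 <= beta%:R :> R by rewrite ler1n.
set b : R := beta%:R in pP pX b1.
have le2 : b * n ^+ 2 * Z <= 2^-1 * n ^+ 2 * Z + (t * a)^-1 * ((2 * b * n - b + 2) * S).
  rewrite -pP -pX (_ : 2^-1 * n ^+ 2 * Z + (t * a)^-1 * (p * X) =
     p * ((2 * p)^-1 * n * n * Z + (t * a)^-1 * X)).
    by rewrite ler_pM2l.
  by field; rewrite !gt_eqF.
have le3 : (2 * b * n - b + 2) * S <= 4 * b * n * S by rewrite ler_wpM2r//; nra.
have le4 : b * n ^+ 2 * Z - 2^-1 * n ^+ 2 * Z >= 2^-1 * b * n ^+ 2 * Z.
  rewrite -subr_ge0 (_ : _ - _ = 2^-1 * (b - 1) * n ^+ 2 * Z); last by field.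
  by rewrite mulr_ge0// mulr_ge0 ?sqr_ge0// mulr_ge0// subr_ge0.
have le5 : (t * a)^-1 * ((2 * b * n - b + 2) * S) <= (t * a)^-1 * (4 * b * n * S).
  by rewrite ler_wpM2l// invr_ge0 ltW.
have le6 : 2^-1 * b * n ^+ 2 * Z <= (t * a)^-1 * (4 * b * n * S) by lra.
have le7 : t * a * (2^-1 * b * n ^+ 2 * Z) <= 4 * b * n * S.
  by rewrite -ler_pdivlMl.
have bn0 : 0 < 4 * b * n by rewrite !mulr_gt0//; lra.
(* The factor 1/2 kept in [le4] divided by the 4 of [le3] is the 1/8 of the statement. *)
rewrite -(ler_pM2l bn0); apply: le_trans le7.
by rewrite le_eqVlt; apply/orP; left; apply/eqP; field.
Qed.

End moment_relations.

(** * Exchangeability of the coordinates and the Cauchy-Schwarz inequality *)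

Section exchangeability.
Context {R : realType}.

Lemma lpnorm2_sqr n (x : n.-tuple R) : lpnorm 2 x ^+ 2 = sumsq x.
Proof.
rewrite /lpnorm -powR_mulrn ?powR_ge0// -powRrM mulVf ?pnatr_eq0// powRr1; last first.
  by apply: sumr_ge0 => i _; exact: powR_ge0.
by apply: eq_bigr => i _; rewrite powR_mulrn// real_normK ?num_real.
Qed.

Lemma Mint_coord beta p m (f : R -> R) (i : 'I_m.+1) : 1 <= p ->
  wint beta p (fun x : m.+1.-tuple R => f (tnth x ord0)) ->
  Mint beta p (fun x : m.+1.-tuple R => f (tnth x i)) =
  Mint beta p (fun x : m.+1.-tuple R => f (tnth x ord0)).
Proof.
move=> p1 hw; rewrite -[RHS](Mint_perm (tperm ord0 i) p1 hw).
by congr Mint; apply/funext => x; rewrite tnth_perm_tuple tpermL.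
Qed.

Lemma Mint_coord_sum beta p m (f : R -> R) : 1 <= p ->
  (forall i, wint beta p (fun x : m.+1.-tuple R => f (tnth x i))) ->
  Mint beta p (fun x : m.+1.-tuple R => \sum_i f (tnth x i)) =
  m.+1%:R * Mint beta p (fun x : m.+1.-tuple R => f (tnth x ord0)).
Proof.
move=> p1 hw; rewrite (Mint_sum _ hw) (eq_bigr _ (fun i _ => Mint_coord i p1 (hw ord0))).
exact: sum_ord_const.
Qed.

Lemma Mint_sumsq_coord beta p m : 1 <= p ->
  Mint beta p (fun x : m.+1.-tuple R => sumsq x) =
  m.+1%:R * Mint beta p (fun x : m.+1.-tuple R => tnth x ord0 ^+ 2).
Proof.
move=> p1; apply: (Mint_coord_sum (f := fun z => z ^+ 2)) => // i.
by apply: (wint_tame beta p1); exact: tame_sqr.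
Qed.

Lemma Mint_sumquart_coord beta p m : 1 <= p ->
  Mint beta p (fun x : m.+1.-tuple R => sumquart x) =
  m.+1%:R * Mint beta p (fun x : m.+1.-tuple R => (tnth x ord0 ^+ 2) ^+ 2).
Proof.
move=> p1; apply: (Mint_coord_sum (f := fun z => (z ^+ 2) ^+ 2)) => // i.
by apply: (wint_tame beta p1); apply: tameX; exact: tame_sqr.
Qed.

Lemma Mint_pair beta p m (i k : 'I_m.+2) : 1 <= p -> i != k ->
  Mint beta p (fun x : m.+2.-tuple R => tnth x i ^+ 2 * tnth x k ^+ 2) =
  Mint beta p (fun x : m.+2.-tuple R => tnth x ord0 ^+ 2 * tnth x (lift ord0 ord0) ^+ 2).
Proof.
move=> p1 ik; set o : 'I_m.+2 := lift ord0 ord0.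
(* [s] sends 0 to i and 1 to k: the first transposition takes 0 to i and 1 to j, the second takes j
   to k and fixes i, which differs from both. *)
pose j := tperm ord0 i o; pose s := (tperm ord0 i * tperm j k)%g.
have ij : i != j by rewrite -(inj_eq (@perm_inj _ (tperm ord0 i))) tpermR tpermK.
have s0 : s ord0 = i by rewrite permM tpermL tpermD// eq_sym.
have s1 : s o = k by rewrite permM -/j tpermL.
have hw : wint beta p (fun x : m.+2.-tuple R => tnth x ord0 ^+ 2 * tnth x o ^+ 2).
  by apply: (wint_tame beta p1); apply: tameM; exact: tame_sqr.
rewrite -(Mint_perm s p1 hw); congr Mint; apply/funext => x.
by rewrite !tnth_perm_tuple s0 s1.
Qed.

Lemma Mint_sumsq_sqr beta p m : 1 <= p ->
  Mint beta p (fun x : m.+2.-tuple R => sumsq x ^+ 2) =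
  m.+2%:R * Mint beta p (fun x : m.+2.-tuple R => (tnth x ord0 ^+ 2) ^+ 2) +
  m.+2%:R * (m.+2%:R - 1) *
    Mint beta p (fun x : m.+2.-tuple R => tnth x ord0 ^+ 2 * tnth x (lift ord0 ord0)
      ^+ 2).
Proof.
move=> p1.
pose F (i k : 'I_m.+2) (x : m.+2.-tuple R) := tnth x i ^+ 2 * tnth x k ^+ 2.
have wF i k : wint beta p (F i k).
  by apply: (wint_tame beta p1); apply: tameM; exact: tame_sqr.
have wFF i : wint beta p (fun x => \sum_k F i k x) by exact: wint_sum.
have -> : (fun x : m.+2.-tuple R => sumsq x ^+ 2) = fun x => \sum_i \sum_k F i k x.
  apply/funext => x; rewrite expr2 /sumsq mulr_suml.
  by apply: eq_bigr => i _; rewrite mulr_sumr.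
rewrite (Mint_sum _ wFF).
have e i : Mint beta p (fun x => \sum_k F i k x) =
    Mint beta p (fun x : m.+2.-tuple R => (tnth x ord0 ^+ 2) ^+ 2) +
    (m.+2%:R - 1) * Mint beta p (fun x : m.+2.-tuple R => tnth x ord0 ^+ 2 * tnth x
      (lift ord0 ord0) ^+ 2).
  rewrite (Mint_sum _ (wF i)) (bigD1 i)//=; congr (_ + _).
    rewrite -(Mint_coord (f := fun z => (z ^+ 2) ^+ 2) i p1).
      by congr Mint; apply/funext => x; rewrite expr2.
    by apply: (wint_tame beta p1); apply: tameX; exact: tame_sqr.
  under eq_bigr => k ki do rewrite (Mint_pair beta p1 (_ : i != k)) 1?eq_sym//.
  by rewrite sum_neq sum_ord_const mulrBl mul1r.
rewrite (eq_bigr _ (fun i _ => e i)) sum_ord_const mulrDr.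
ring.
Qed.

(** Write s for the sum of squares, E and A for the integrals of s and s^2, and Z > 0 for the total
    mass. The integral of (Z s - E)^2 equals Z (Z A - E^2). *)
Lemma Mint_sumsq_CauchySchwarz beta p n : 1 <= p ->
  Mint beta p (fun x : n.-tuple R => sumsq x) ^+ 2 <=
  Mint beta p (fun _ : n.-tuple R => 1) * Mint beta p (fun x : n.-tuple R => sumsq x
    ^+ 2).
Proof.
move=> p1; have Z0 := @Mint1_gt0 R beta p n p1.
have w1 : wint beta p (fun _ : n.-tuple R => 1).
  by apply: (wint_tame beta p1); exact: tame_cst.
have wS : wint beta p (fun x : n.-tuple R => sumsq x).
  by apply: (wint_tame beta p1); exact: tame_sumsq.
have wS2 : wint beta p (fun x : n.-tuple R => sumsq x ^+ 2).
  by apply: (wint_tame beta p1); apply: tameX; exact: tame_sumsq.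
set Z := Mint _ _ (fun=> 1) in Z0 *; set S := Mint _ _ (fun x => sumsq x); set A :=
  Mint _ _ _.
have : 0 <= Mint beta p (fun x : n.-tuple R => (Z * sumsq x - S * 1) ^+ 2).
  by apply: Mint_ge0 => x; exact: sqr_ge0.
rewrite (_ : (fun x => _) = fun x : n.-tuple R =>
   Z ^+ 2 * sumsq x ^+ 2 - 2 * Z * S * sumsq x + S ^+ 2 * 1); last first.
  by apply/funext => x; ring.
rewrite MintD; [|by apply: wintB; exact: wintZ|exact: wintZ].
rewrite MintB; [|exact: wintZ..].
rewrite !MintZ// -/Z -/S -/A => h.
rewrite -(ler_pM2l Z0) -subr_ge0; move: h; congr (0 <= _); ring.
Qed.

End exchangeability.

(** * Bounds for the normalized moments *)

Section means.
Context {R : realType}.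

Lemma Mmom2E beta (p : R) m :
  Mmom beta p m.+1 0 2 = Mint beta p (fun x : m.+1.-tuple R => tnth x ord0 ^+ 2) /
    Mint beta p (fun _ : m.+1.-tuple R => 1).
Proof.
rewrite /Mmom /Mmean; congr (_ / _); congr Mint; apply/funext => x.
by rewrite (tnth_nth 0).
Qed.

Lemma Mmom4E beta (p : R) m :
  Mmom beta p m.+1 0 4 = Mint beta p (fun x : m.+1.-tuple R => (tnth x ord0 ^+ 2) ^+ 2) /
    Mint beta p (fun _ : m.+1.-tuple R => 1).
Proof.
rewrite /Mmom /Mmean; congr (_ / _); congr Mint; apply/funext => x.
by rewrite (tnth_nth 0) -exprM.
Qed.

(** By symmetry both sums are n times the moment of one coordinate. From n = 26 on, the factor 3/2 -
    13/n is nonnegative, so the Cauchy-Schwarz inequality may be multiplied by it. *)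
Lemma Mmom_fourth_ge beta (p : R) n : (0 < beta)%N -> 1 <= p -> (26 <= n)%N ->
  (3 / 2 - 13 / n%:R) * Mmom beta p n 0 2 ^+ 2 <= Mmom beta p n 0 4.
Proof.
case: n => [//|m] beta0 p1 n26; rewrite Mmom2E Mmom4E.
have Z0 := @Mint1_gt0 R beta p m.+1 p1.
have := @sumsq_sqr_le_sumquart R beta p m.+1 beta0 p1 (leq_trans (isT : 2 <= 26)%N n26).
have := @Mint_sumsq_CauchySchwarz R beta p m.+1 p1.
rewrite Mint_sumsq_coord// Mint_sumquart_coord//.
set Z := Mint _ _ (fun=> 1) in Z0 *; set a := Mint _ _ _; set A := Mint _ _ _.
set b := Mint _ _ _; set n : R := m.+1%:R => h1 h2.
have n0 : 26 <= n by rewrite ler_nat.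
have c0 : 0 <= 3 / 2 - 13 / n.
  by rewrite subr_ge0 ler_pdivrMr; lra.
rewrite expr_div_n mulrA ler_pdivlMr// mulrAC ler_pdivrMr ?exprn_gt0//.
have n2 : 0 < n ^+ 2 by rewrite exprn_gt0//; lra.
rewrite -(ler_pM2l n2).
rewrite (_ : n ^+ 2 * _ = (3 / 2 - 13 / n) * ((n * a) ^+ 2) * Z); last by ring.
apply: (@le_trans _ _ ((3 / 2 - 13 / n) * (Z * A) * Z)).
  by rewrite ler_wpM2r ?(ltW Z0)// ler_wpM2l.
rewrite (_ : (3 / 2 - 13 / n) * (Z * A) * Z = (3 / 2 - 13 / n) * A * Z ^+ 2); last by
  ring.
rewrite (_ : n ^+ 2 * _ = n * (n * b) * Z ^+ 2); last by ring.
by rewrite ler_wpM2r ?sqr_ge0.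
Qed.

Lemma Mmom_second_le beta (p : R) n : (0 < beta)%N -> (beta <= 4)%N -> 1 <= p ->
  (0 < n)%N -> Mmom beta p n 0 2 <= 800 * n%:R `^ (2 / p).
Proof.
case: n => [//|m] beta0 beta4 p1 n0; rewrite Mmom2E.
have Z0 := @Mint1_gt0 R beta p m.+1 p1; rewrite ler_pdivrMr//.
have := @Mint_sumsq_le R beta p m.+1 beta0 beta4 p1 n0.
rewrite Mint_sumsq_coord// -[_ * m.+1%:R * _]mulrA mulrCA ler_pM2l ?ltr0n//.
Qed.

Lemma Mmom_second_ge beta (p : R) n : (0 < beta)%N -> 1 <= p ->
  (0 < n)%N -> expR (- 4) / 8 * n%:R `^ (2 / p) <= Mmom beta p n 0 2.
Proof.
case: n => [//|m] beta0 p1 n0; rewrite Mmom2E.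
have Z0 := @Mint1_gt0 R beta p m.+1 p1; rewrite ler_pdivlMr//.
have := @Mint_sumsq_ge R beta p m.+1 beta0 p1 n0.
rewrite Mint_sumsq_coord// -[_ * m.+1%:R * _]mulrA mulrCA ler_pM2l ?ltr0n//.
Qed.

Lemma Mvar_sqrE beta (p : R) n :
  Mvar beta p (fun x : n.-tuple R => x`_0 ^+ 2) = Mmom beta p n 0 4 - Mmom beta p n 0
    2 ^+ 2.
Proof.
rewrite /Mvar /Mmom; congr (Mmean _ _ _ - _).
by apply/funext => x; rewrite -exprM.
Qed.

Lemma Mvar_sqnormE beta (p : R) n : 1 <= p -> (2 <= n)%N ->
  Mvar_sqnorm beta p n =
  n%:R * Mvar beta p (fun x : n.-tuple R => x`_0 ^+ 2) +
  n%:R * (n%:R - 1) * cross_term beta p n.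
Proof.
case: n => [//|[//|m]] p1 _.
rewrite Mvar_sqrE /cross_term Mmom2E Mmom4E /Mvar_sqnorm /Mvar /Mmean.
have -> : (fun x : m.+2.-tuple R => x`_0 ^+ 2 * x`_1 ^+ 2) =
    fun x => tnth x ord0 ^+ 2 * tnth x (lift ord0 ord0) ^+ 2.
  by apply/funext => x; rewrite !(tnth_nth 0).
have -> : (fun x : m.+2.-tuple R => lpnorm 2 x ^+ 2) = fun x => sumsq x.
  by apply/funext => x; exact: lpnorm2_sqr.
have -> : (fun x : m.+2.-tuple R => (lpnorm 2 x ^+ 2) ^+ 2) = fun x => sumsq x ^+ 2.
  by apply/funext => x; rewrite lpnorm2_sqr.
rewrite Mint_sumsq_sqr// Mint_sumsq_coord//.
field; rewrite gt_eqF//; exact: Mint1_gt0.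
Qed.

End means.

(** The errors are explicit: -13/n for the fourth moment, and -13 after multiplication by n. The
    constants come from the bounds on the second moment, which are uniform in p and in beta. *)
Theorem theorem5 (R : realType) :
  exists c1 c2 : R, [/\ 0 < c1, 0 < c2 &
  forall (beta : nat) (p : nat -> R),
    beta \in [:: 1; 2; 4]%N ->
    (forall n, 1 <= p n) ->
    [/\
      exists e : nat -> R,
        (e n @[n --> \oo] --> (0 : R)) /\
        (\forall n \near \oo,
          Mmom beta (p n) n 0 4 >= (3 / 2 + e n) * Mmom beta (p n) n 0 2 ^+ 2),
      exists e : nat -> R,
        [/\ e n / n%:R @[n --> \oo] --> (0 : R),
            (\forall n \near \oo,
              n%:R * Mvar beta (p n) (fun x : n.-tuple R => x`_0 ^+ 2) >=
              (n%:R / 2 + e n) * Mmom beta (p n) n 0 2 ^+ 2) &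
            (\forall n \near \oo,
              c1 * ((n%:R / 2 + e n) * Mmom beta (p n) n 0 2 ^+ 2) <=
                n%:R * n%:R `^ (4 / p n) <=
              c2 * ((n%:R / 2 + e n) * Mmom beta (p n) n 0 2 ^+ 2))],
      forall n : nat, (2 <= n)%N ->
        Mvar_sqnorm beta (p n) n =
        n%:R * Mvar beta (p n) (fun x : n.-tuple R => x`_0 ^+ 2) +
        n%:R * (n%:R - 1) * cross_term beta (p n) n,
      (exists C : R, \forall n \near \oo,
         Mvar_sqnorm beta (p n) n <= C * n%:R `^ (4 / p n)) ->
      \forall n \near \oo, cross_term beta (p n) n < 0 &
      (Mvar_sqnorm beta (p n) n / (n%:R * n%:R `^ (4 / p n))
         @[n --> \oo] --> (0 : R)) ->
      \forall n \near \oo, cross_term beta (p n) n < 0]].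
Proof.
pose t : R := expR (- 4) / 8.
have t0 : 0 < t by rewrite divr_gt0 ?expR_gt0.
have [K K0 hK] : exists2 K : R, 0 < K &
    forall beta (p : R) n, (0 < beta)%N -> (beta <= 4)%N -> 1 <= p -> (0 < n)%N ->
      Mmom beta p n 0 2 <= K * n%:R `^ (2 / p).
  by exists 800; [rewrite ltr0n|move=> beta p n; exact: Mmom_second_le].
exists (K ^- 2), (4 / t ^+ 2); split.
- by rewrite invr_gt0 exprn_gt0.
- by rewrite divr_gt0// exprn_gt0.
move=> beta p hb p1.
have [beta0 beta4] : (0 < beta)%N /\ (beta <= 4)%N.
  by move: hb; rewrite !inE => /or3P[] /eqP ->.
have e0 : (- 13 / n%:R : R) @[n --> \oo] --> (0 : R).
  rewrite -[X in _ --> X](mulr0 (- 13)); apply: cvgM; first exact: cvg_cst.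
  rewrite -cvg_shiftS; exact: cvg_harmonic.
have sqE n : n%:R `^ (4 / p n) = (n%:R `^ (2 / p n)) ^+ 2 :> R.
  rewrite -powR_mulrn ?powR_ge0// -powRrM; congr (_ `^ _).
  by rewrite mulrAC -natrM.
have four n : (26 <= n)%N ->
    (3 / 2 + - 13 / n%:R) * Mmom beta (p n) n 0 2 ^+ 2 <= Mmom beta (p n) n 0 4.
  by move=> n26; rewrite mulNr; exact: Mmom_fourth_ge.
have var n : (26 <= n)%N ->
    (n%:R / 2 + - 13) * Mmom beta (p n) n 0 2 ^+ 2 <=
    n%:R * Mvar beta (p n) (fun x : n.-tuple R => x`_0 ^+ 2).
  move=> n26; rewrite Mvar_sqrE.
  have n0 : n%:R != 0 :> R by rewrite pnatr_eq0; case: n n26.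
  rewrite (_ : (n%:R / 2 + - 13) * _ = n%:R * ((3 / 2 + - 13 / n%:R) *
    Mmom beta (p n) n 0 2 ^+ 2 - Mmom beta (p n) n 0 2 ^+ 2)); last by field.
  by rewrite ler_wpM2l// lerD2r; exact: four.
(* From n = 52 on, n/4 <= n/2 - 13 <= n: the quarter gives the 4 in [c2]. [K] and [t] are the upper
   and lower constants comparing the second moment with n^(2/p). *)
have size n : (52 <= n)%N ->
    K ^- 2 * ((n%:R / 2 + - 13) * Mmom beta (p n) n 0 2 ^+ 2) <=
      n%:R * n%:R `^ (4 / p n) <=
    4 / t ^+ 2 * ((n%:R / 2 + - 13) * Mmom beta (p n) n 0 2 ^+ 2).
  move=> n52; have n0 : (0 < n)%N by case: n n52.
  have nR : 52 <= n%:R :> R by rewrite (ler_nat _ 52).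
  have := hK beta (p n) n beta0 beta4 (p1 n) n0.
  have := Mmom_second_ge beta0 (p1 n) n0; rewrite -/t.
  have := powR_ge0 (n%:R : R) (2 / p n); rewrite sqE.
  move: (n%:R `^ _) (Mmom _ _ _ _ _) => a m a0 h1 h2.
  have m0 : 0 <= m by apply: le_trans h1; rewrite mulr_ge0// ltW.
  have q1 : m ^+ 2 <= K ^+ 2 * a ^+ 2.
    by rewrite -exprMn lerXn2r ?nnegrE// mulr_ge0// ltW.
  have q2 : t ^+ 2 * a ^+ 2 <= m ^+ 2.
    by rewrite -exprMn lerXn2r ?nnegrE// mulr_ge0// ltW.
  apply/andP; split.
    rewrite ler_pdivrMl ?exprn_gt0// [leRHS]mulrCA.
    by apply: ler_pM; [lra|exact: sqr_ge0|lra|exact: q1].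
  rewrite mulrAC ler_pdivlMr ?exprn_gt0// -mulrA [a ^+ 2 * _]mulrC.
  apply: (@le_trans _ _ (n%:R * m ^+ 2)); first by rewrite ler_wpM2l.
  by rewrite [leRHS]mulrA; apply: ler_wpM2r; [exact: sqr_ge0|lra].
have idn n : (2 <= n)%N -> Mvar_sqnorm beta (p n) n =
    n%:R * Mvar beta (p n) (fun x : n.-tuple R => x`_0 ^+ 2) +
    n%:R * (n%:R - 1) * cross_term beta (p n) n.
  by move=> n2; exact: Mvar_sqnormE.
(* By [size] and [var] the first summand of [idn] is at least n n^(4/p) / c2, so a smaller total
   forces the cross term to be negative. *)
have neg n : (52 <= n)%N ->
    Mvar_sqnorm beta (p n) n < (4 / t ^+ 2)^-1 * (n%:R * n%:R `^ (4 / p n)) ->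
    cross_term beta (p n) n < 0.
  move=> n52; rewrite idn ?(leq_trans _ n52)//.
  have nR : 52 <= n%:R :> R by rewrite (ler_nat _ 52).
  have /andP[_ h1] := size n n52; have h2 := var n (leq_trans (isT : 26 <= 52)%N n52).
  rewrite -ler_pdivrMl in h1; last by rewrite divr_gt0// exprn_gt0.
  move/lt_le_trans => /(_ _ (le_trans h1 h2)).
  by rewrite gtrDl pmulr_rlt0// mulr_gt0//; lra.
split.
- exists (fun n => - 13 / n%:R); split=> //.
  by near=> n; apply: four; near: n; exact: nbhs_infty_ge.
- exists (fun=> - 13); split=> //.
  + by near=> n; apply: var; near: n; exact: nbhs_infty_ge.
  + by near=> n; apply: size; near: n; exact: nbhs_infty_ge.
- exact: idn.
- move=> [C hC]; near=> n; apply: neg; first by near: n; exact: nbhs_infty_ge.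
  have n0 : (0 < n)%N by near: n; exact: nbhs_infty_ge.
  apply: (@le_lt_trans _ _ (C * n%:R `^ (4 / p n))); first by near: n.
  (* C n^(4/p) drops below the required level as soon as n > 4 C / t^2. *)
  rewrite mulrA ltr_pM2r ?powR_gt0 ?ltr0n//.
  rewrite mulrC ltr_pdivlMr ?divr_gt0 ?exprn_gt0//.
  by near: n; exact: nbhs_infty_gtr.
- move=> h; near=> n; apply: neg; first by near: n; exact: nbhs_infty_ge.
  have n0 : (0 < n)%N by near: n; exact: nbhs_infty_ge.
  rewrite -ltr_pdivrMr; last by rewrite mulr_gt0 ?powR_gt0 ?ltr0n.
  near: n; apply: (cvgr_lt 0) => //.
  by rewrite invr_gt0 divr_gt0// exprn_gt0.
Unshelve. all: by end_near. Qed.
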